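(* Let $\theta_1,\theta_2,\theta_3\in(0,\pi/2)$ and on $\mathbb C^2\otimes\mathbb C^2\otimes\mathbb C^2$ (three parties, one qubit each) define $|A\rangle=\cos\theta_1|0\rangle+\sin\theta_1|1\rangle$, $|B\rangle=\cos\theta_2|0\rangle+\sin\theta_2|1\rangle$, $|C\rangle=\cos\theta_3|0\rangle+\sin\theta_3|1\rangle$, and let $|A^\perp\rangle,|B^\perp\rangle,|C^\perp\rangle$ be unit vectors orthogonal to $|A\rangle,|B\rangle,|C\rangle$ respectively. Let $$|S_1\rangle=|0\rangle|0\rangle|0\rangle,\ |S_2\rangle=|1\rangle|B\rangle|C\rangle,\ |S_3\rangle=|A\rangle|1\rangle|C^\perp\rangle,\ |S_4\rangle=|A^\perp\rangle|B^\perp\rangle|1\rangle,$$ and $S=\mathrm{span}\{|S_1\rangle,|S_2\rangle,|S_3\rangle,|S_4\rangle\}$. Then $S$ is locally indistinguishable, i.e. no orthonormal basis of $S$ is perfectly distinguishable by LOCC; however, $S$ has an orthonormal basis that is perfectly distinguishable by separable operations.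
   Context: ''Perfectly distinguishable by LOCC'': there is a finite-round protocol, in each round one of the three parties performing a local measurement and broadcasting the outcome, that identifies with probability 1 which state of the set was given. ''Perfectly distinguishable by separable operations'': there is a measurement $\{M_m\}$ with $\sum_m M_m^\dagger M_m=I$, each $M_m=A_m\otimes B_m\otimes C_m$ a product of local operators, and a map from outcomes to indices, such that for each state of the set the outcome identifies its index with probability 1. *)

(* Defs.v *)
From HB Require Import structures.
From mathcomp Require Import all_boot all_order all_algebra.
Set Implicit Arguments.
Unset Strict Implicit.
Unset Printing Implicit Defensive.
Import Order.TTheory GRing.Theory Num.Theory.
Local Open Scope ring_scope.

Section QDefs.
Variable C : numClosedFieldType.

Definition adj m n (A : 'M[C]_(m, n)) : 'M[C]_(n, m) := (map_mx Num.conj A)^T.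

Definition sqnorm n (v : 'cV[C]_n) : C := \sum_i `|v i 0| ^+ 2.

Definition ket0 : 'cV[C]_2 := \col_i (if i == 0 :> nat then 1 else 0).
Definition ket1 : 'cV[C]_2 := \col_i (if i == 1 :> nat then 1 else 0).

(* Three qubits: C^2 (x) C^2 (x) C^2 = C^8, basis index i <-> bits
   (i / 4, (i / 2) mod 2, i mod 2) for parties 1, 2, 3. *)
Definition bit1 (i : 'I_8) : 'I_2 := inord (i %/ 4).
Definition bit2 (i : 'I_8) : 'I_2 := inord ((i %/ 2) %% 2).
Definition bit3 (i : 'I_8) : 'I_2 := inord (i %% 2).

Definition ket3 (a b c : 'cV[C]_2) : 'cV[C]_8 :=
  \col_i (a (bit1 i) 0 * b (bit2 i) 0 * c (bit3 i) 0).

Definition kron3 (A B D : 'M[C]_2) : 'M[C]_8 :=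
  \matrix_(i, j) (A (bit1 i) (bit1 j) * B (bit2 i) (bit2 j) * D (bit3 i) (bit3 j)).

Definition local_op (p : 'I_3) (K : 'M[C]_2) : 'M[C]_8 :=
  if p == 0 :> nat then kron3 K 1 1
  else if p == 1 :> nat then kron3 1 K 1
  else kron3 1 1 K.

Definition orthonormal_basis_of n k (S : 'M[C]_(8, n)) (B : 'M[C]_(8, k)) :=
  adj B *m B = 1%:M /\ (B^T == S^T)%MS.

(* Finite-round LOCC protocols for three parties: a finite tree.  At a
   node, party p performs a local measurement with Kraus operators K_m
   (one child per outcome m, outcome broadcast); the protocol continues
   with the subtree of that outcome.  A leaf announces a guess (an index). *)
Inductive locc : Type :=
| Leaf : nat -> locc
| Node : 'I_3 -> seq ('M[C]_2 * locc) -> locc.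

Fixpoint locc_valid (t : locc) : Prop :=
  match t with
  | Leaf _ => True
  | Node p ks =>
      \sum_(x <- ks) adj x.1 *m x.1 = 1%:M /\
      (fix all_valid (l : seq ('M[C]_2 * locc)) : Prop :=
         match l with
         | [::] => True
         | (K, t') :: l' => locc_valid t' /\ all_valid l'
         end) ks
  end.

Fixpoint locc_leaves (t : locc) : seq ('M[C]_8 * nat) :=
  match t with
  | Leaf g => [:: (1%:M, g)]
  | Node p ks =>
      (fix go (l : seq ('M[C]_2 * locc)) : seq ('M[C]_8 * nat) :=
         match l with
         | [::] => [::]
         | (K, t') :: l' =>
             [seq (x.1 *m local_op p K, x.2) | x <- locc_leaves t'] ++ go l'
         end) ks
  end.

(* The states given by the columns of B (indexed by j : 'I_k) are
   perfectly distinguishable by LOCC: for each j, when the protocol is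
   run on column j, the probability that the announced guess is j is 1. *)
Definition locc_distinguishable k (B : 'M[C]_(8, k)) : Prop :=
  exists t : locc, locc_valid t /\
    forall j : 'I_k,
      \sum_(x <- locc_leaves t | x.2 == j) sqnorm (x.1 *m col j B) = 1.

(* Perfectly distinguishable by separable operations: a measurement
   {M_m = A_m (x) B_m (x) C_m} with sum_m M_m^dagger M_m = I and a map f
   from outcomes to indices, correct with probability 1 on each state. *)
Definition sep_distinguishable k (B : 'M[C]_(8, k)) : Prop :=
  exists (n : nat) (M : 'I_n -> 'M[C]_2 * 'M[C]_2 * 'M[C]_2) (f : 'I_n -> 'I_k),
    let Mop m := kron3 (M m).1.1 (M m).1.2 (M m).2 in
    \sum_m adj (Mop m) *m Mop m = 1%:M /\
    forall j : 'I_k, \sum_(m | f m == j) sqnorm (Mop m *m col j B) = 1.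

(* The single-qubit state cos(theta)|0> + sin(theta)|1>, given by
   c = cos theta and s = sin theta *)
Definition qstate (c s : C) : 'cV[C]_2 := c *: ket0 + s *: ket1.

Definition Smat (A Ap B Bp Cc Cp : 'cV[C]_2) : 'M[C]_(8, 4) :=
  \matrix_(i, j)
    (if j == 0 :> nat then ket3 ket0 ket0 ket0 i 0
     else if j == 1 :> nat then ket3 ket1 B Cc i 0
     else if j == 2 :> nat then ket3 A ket1 Cp i 0
     else ket3 Ap Bp ket1 i 0).

End QDefs.

(* Main.v *)
(* Indistinguishability.  Let X1 (x) X2 (x) X3 be the operator accumulated at a node
   of a perfect protocol and E_i = X_i^dagger X_i.  Since the states that reach a node
   stay orthogonal, the operator E1 (x) E2 (x) E3 compressed to S is diagonal in the
   given basis, so all these compressions commute; in the basis S_1, ..., S_4 they are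
   entrywise products of three 4 x 4 Gram matrices.  Say party 1 makes the first
   nontrivial measurement.  Its elements all have the form m + t E0 with t real, and as
   they sum to a scalar both signs of t occur.  Following t > 0 and t < 0 down the tree
   until another party acts (a leaf would need a compression of rank at most 1) yields
   (E, F) and (E', F') with opposite traceless parts of E, E' and nonscalar F, F'.
   The commutation relations of E (x) 1, E (x) F, E' (x) 1, E' (x) F' are inconsistent.

   Separable measurement.  S_2, S_3, S_4 extend to an orthonormal product basis of the
   whole space; its other five vectors announce S_1. *)
Require Import Defs.
From HB Require Import structures.
From mathcomp Require Import all_boot all_order all_algebra.
From mathcomp Require Import ring.
Set Implicit Arguments.
Unset Strict Implicit.
Unset Printing Implicit Defensive.
Import Order.TTheory GRing.Theory Num.Theory.
Local Open Scope ring_scope.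

(** * Adjoints and squared norms *)

Section Adjoint.
Variable C : numClosedFieldType.
Local Notation adj := (@adj C _ _).

Lemma daggerE m n (A : 'M[C]_(m, n)) i j : adj A i j = (A j i)^*.
Proof. by rewrite !mxE. Qed.

Lemma daggerK m n (A : 'M[C]_(m, n)) : adj (adj A) = A.
Proof. by apply/matrixP=> i j; rewrite !daggerE conjCK. Qed.

Lemma daggerM m n p (A : 'M[C]_(m, n)) (B : 'M[C]_(n, p)) :
  adj (A *m B) = adj B *m adj A.
Proof. by rewrite /Defs.adj map_mxM trmx_mul. Qed.

Lemma dagger1 n : adj (1%:M : 'M[C]_n) = 1%:M.
Proof. by rewrite /Defs.adj map_mx1 trmx1. Qed.

Lemma sqnormE n (v : 'cV[C]_n) : sqnorm v = (adj v *m v) 0 0.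
Proof. by rewrite mxE; apply: eq_bigr => i _; rewrite daggerE normCK mulrC. Qed.

Lemma sqnorm_ge0 n (v : 'cV[C]_n) : 0 <= sqnorm v.
Proof. by apply: sumr_ge0 => i _; rewrite exprn_ge0. Qed.

Lemma sqnorm_eq0 n (v : 'cV[C]_n) : sqnorm v = 0 -> v = 0.
Proof.
move=> v0; apply/colP=> i; rewrite mxE; apply/eqP.
have /psumr_eq0P/(_ v0 i isT)/eqP : forall i, true -> 0 <= `|v i 0| ^+ 2.
  by move=> k _; rewrite exprn_ge0.
by rewrite sqrf_eq0 normr_eq0.
Qed.

End Adjoint.

(** * Product vectors and product operators on three qubits *)

Section Kron.
Variable C : numClosedFieldType.
Local Notation adj := (@adj C _ _).

(** The three bits run independently over their values, so the sum factors. The rules for products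
    and inner products of [kron3] and [ket3] reduce to this. *)
Lemma sum_bits (f g h : 'I_2 -> C) :
  \sum_(i < 8) f (bit1 i) * g (bit2 i) * h (bit3 i) =
  (\sum_i f i) * (\sum_i g i) * (\sum_i h i).
Proof.
rewrite !big_ord_recl !big_ord0.
have b k (i : 'I_2) : k = i :> nat -> inord k = i :> 'I_2.
  by move=> ->; rewrite inord_val.
rewrite /bit1 /bit2 /bit3 /=.
rewrite !(b 0%N ord0) // !(b 1%N (lift ord0 ord0)) //.
ring.
Qed.

Lemma bits_inj (i j : 'I_8) :
  bit1 i = bit1 j -> bit2 i = bit2 j -> bit3 i = bit3 j -> i = j.
Proof.
move=> /(congr1 val) + /(congr1 val) + /(congr1 val).
rewrite /= !inordK ?ltn_mod ?ltn_divLR //= => e1 e2 e3; apply/val_inj => /=.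
(* Two Euclidean divisions by 2 rebuild an index from its three bits. *)
rewrite (divn_eq i 2) (divn_eq j 2) e3 (divn_eq (i %/ 2) 2) e2.
by rewrite -divnMA e1 (divnMA j 2 2) -divn_eq.
Qed.

Lemma kron3_1 : kron3 1 1 1 = 1%:M :> 'M[C]_8.
Proof.
apply/matrixP=> i j; rewrite !mxE.
case: (eqVneq i j) => [->|nij]; first by rewrite !eqxx !mulr1.
case: eqP => [e1|]; last by rewrite !mul0r.
case: eqP => [e2|]; last by rewrite mulr0 mul0r.
case: eqP => [e3|]; last by rewrite mulr0.
by case/eqP: nij; apply: bits_inj.
Qed.

Lemma kron3M (A B D A' B' D' : 'M[C]_2) :
  kron3 A B D *m kron3 A' B' D' = kron3 (A *m A') (B *m B') (D *m D').
Proof.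
apply/matrixP=> i j; rewrite !mxE -(sum_bits _ _ _).
by apply: eq_bigr => k _; rewrite !mxE; ring.
Qed.

Lemma kron3_ket3 (A B D : 'M[C]_2) (x y z : 'cV[C]_2) :
  kron3 A B D *m ket3 x y z = ket3 (A *m x) (B *m y) (D *m z).
Proof.
apply/matrixP=> i j; rewrite !mxE -(sum_bits _ _ _).
by apply: eq_bigr => k _; rewrite !mxE; ring.
Qed.

Lemma adj_kron3 (A B D : 'M[C]_2) :
  adj (kron3 A B D) = kron3 (adj A) (adj B) (adj D).
Proof. by apply/matrixP=> i j; rewrite daggerE !mxE !rmorphM. Qed.

Lemma ket3_dot (x y z x' y' z' : 'cV[C]_2) :
  (adj (ket3 x y z) *m ket3 x' y' z') 0 0 =
  (adj x *m x') 0 0 * (adj y *m y') 0 0 * (adj z *m z') 0 0.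
Proof.
rewrite !mxE -(sum_bits _ _ _).
by apply: eq_bigr => k _; rewrite !mxE !rmorphM; ring.
Qed.

Lemma ket3Z (a b c : C) (x y z : 'cV[C]_2) :
  ket3 (a *: x) (b *: y) (c *: z) = (a * b * c) *: ket3 x y z.
Proof. by apply/matrixP=> i j; rewrite !mxE; ring. Qed.

Lemma kron3Z (a b c : C) (A B D : 'M[C]_2) :
  kron3 (a *: A) (b *: B) (c *: D) = (a * b * c) *: kron3 A B D.
Proof. by apply/matrixP=> i j; rewrite !mxE; ring. Qed.

End Kron.

(** * Scalar relations *)

Section LinearCombination.
Variable R : comNzRingType.

(** Certificate by linear combination: [u = v] is an explicit combination of known equations,
    assembled with [mul_eq] and [add_eq], and the second premise is left to [ring]. *)
Lemma lin_comb (a b u v : R) : u = v -> a - b = u - v -> a = b.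
Proof. by move=> ->; rewrite subrr => /subr0_eq. Qed.

Lemma mul_eq (k u v : R) : u = v -> k * u = k * v.
Proof. by move=> ->. Qed.

Lemma add_eq (u v u' v' : R) : u = v -> u' = v' -> u + u' = v + v'.
Proof. by move=> -> ->. Qed.

End LinearCombination.

Section Scalars.
Variable C : numClosedFieldType.
Implicit Types p r x y f h u w : C.

Lemma real_sqr_gt0 (a : C) : a^* = a -> a != 0 -> 0 < a ^+ 2.
Proof. by move=> aR a0; rewrite expr2 -{2}aR -normCK exprn_gt0 ?normr_gt0. Qed.

(* [[p, x], [y, r]] is Hermitian positive semidefinite. *)
Definition herm_entries (p r x y : C) :=
  [/\ 0 <= p, 0 <= r, y = x^* & 0 <= p * r - x * y].

(** With a zero on the diagonal the determinant is [- |x|^2], and it is nonnegative. *)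
Lemma herm_entries_r0 p r x y : herm_entries p r x y -> r = 0 -> x = 0.
Proof.
move=> [_ _ -> +] r0; rewrite r0 mulr0 sub0r oppr_ge0 -normCK => le.
by apply/eqP; rewrite -normr_eq0 -sqrf_eq0 eq_le le exprn_ge0.
Qed.

Lemma herm_entries_p0 p r x y : herm_entries p r x y -> p = 0 -> x = 0.
Proof.
by move=> [p0 r0 xy]; rewrite mulrC => d; apply: (@herm_entries_r0 r p x y).
Qed.

Section Roles.
Variables (c s c2 s2 : C).
Hypotheses (cR : c^* = c) (sR : s^* = s) (c0 : c != 0) (s0 : s != 0) (cs : c ^+ 2 + s ^+ 2 = 1).
Hypotheses (c20 : c2 != 0) (s20 : s2 != 0) (cs2 : c2 ^+ 2 + s2 ^+ 2 = 1).

(* Party 1 has measured E = [[p, x], [y, r]] and party 2 then measures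
   F = [[f, u], [w, h]]; the premises are the entries of the commutator of the
   two Gram matrices.  q, q', z, z' are the entries of E on the basis A, A^perp,
   and fb, hb, X, X' those of F on B, B^perp.  When p != q the off-diagonal
   blocks vanish and F is forced to be scalar. *)
Lemma bob_scalar p r x y f h u w :
  herm_entries p r x y -> ~ (x = 0 /\ p = r) -> w = u^* ->
  let q := c ^+ 2 * p + c * s * (x + y) + s ^+ 2 * r in
  let q' := s ^+ 2 * p - c * s * (x + y) + c ^+ 2 * r in
  let z := - c * s * (p - r) + c ^+ 2 * x - s ^+ 2 * y in
  let z' := - c * s * (p - r) + c ^+ 2 * y - s ^+ 2 * x in
  let X := - c2 * s2 * (f - h) + c2 ^+ 2 * u - s2 ^+ 2 * w in
  let X' := - c2 * s2 * (f - h) + c2 ^+ 2 * w - s2 ^+ 2 * u in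
  let fb := c2 ^+ 2 * f + c2 * s2 * (u + w) + s2 ^+ 2 * h in
  let hb := s2 ^+ 2 * f - c2 * s2 * (u + w) + c2 ^+ 2 * h in
  x * y * (w - u) = 0 ->
  z * z' * (w - u) = 0 ->
  x * ((p - r) * (c2 * f + s2 * u) - c2 * (p * f - r * fb)) = 0 ->
  z * ((q - q') * (c2 * h - s2 * w) - c2 * (q * h - q' * hb)) = 0 ->
  (c * p + s * x) * u * (p - q) = 0 ->
  (c * r - s * y) * X * (r - q') = 0 ->
  x * (c * r - s * y) * X = - (c * p + s * x) * u * z ->
  z * (c * r - s * x) * X' = - (c * p + s * y) * w * x ->
  (u = 0 /\ f = h) \/
  [/\ s * (p - r) = c * (x + y), w = u,
      (p - r) * (X - u) = (p + r) * (X + u) &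
      (p * r - x * y) * (X + u) = 0].
Proof.
move=> hE nsc wu q q' z z' X X' fb hb e11 e33 e12 e34 e13 e24 e14 e32.
have [p_ge0 r_ge0 yx det_ge0] := hE.
have x0y : x = 0 -> y = 0 by rewrite yx => ->; rewrite conjC0.
have u0w : u = 0 -> w = 0 by rewrite wu => ->; rewrite conjC0.
have n4 : 4 != 0 :> C by rewrite pnatr_eq0.
(* Modulo [cs], [p - q] equals [s * (s * (p - r) - c * (x + y))], so the split is on whether [E] has
   the same expectation in |0> and in |A>. *)
have [w0|nw0] := eqVneq (s * (p - r)) (c * (x + y)).
  have pq : p - q = 0.
    by apply: (lin_comb (add_eq (mul_eq s w0) (mul_eq (- p) cs))); rewrite /q; ring.
  have nx : x != 0.
    apply/eqP=> x0; apply: nsc; split=> //.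
    apply: (mulfI s0); apply: (lin_comb w0).
    by rewrite x0 (x0y x0); ring.
  have ny : y != 0 by rewrite yx conjC_eq0.
  have zy : z = - y.
    by apply: (lin_comb (add_eq (mul_eq (- c) w0) (mul_eq (-y) cs))); rewrite /z; ring.
  have wu' : w = u.
    by apply: subr0_eq; apply: (mulfI (mulf_neq0 nx ny)); rewrite mulr0.
  right; have XX : X' = X by rewrite /X' /X wu'.
  have hXm : X - u = - s2 * (c2 * (f - h) + 2 * s2 * u).
    by apply: (lin_comb (mul_eq u cs2)); rewrite /X wu'; ring.
  have hXp : X + u = - c2 * (s2 * (f - h) - 2 * c2 * u).
    by apply: (lin_comb (mul_eq (- u) cs2)); rewrite /X wu'; ring.
  have hfb : fb = f - s2 * (s2 * (f - h) - 2 * c2 * u).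
    by apply: (lin_comb (mul_eq f cs2)); rewrite /fb wu'; ring.
  have a2 : (p - r) * (X - u) = (p + r) * (X + u).
    have a : (p - r) * (c2 * f + s2 * u) - c2 * (p * f - r * fb) = 0.
      by apply: (mulfI nx); rewrite mulr0.
    apply: (mulfI s20); rewrite hXm hXp; rewrite hfb in a.
    apply: (lin_comb (add_eq (mul_eq (- 2) a)
                             (mul_eq (- 2 * (p - r) * s2 * u) cs2))); ring.
  (* The claim times [4 * s] is twice the difference of [e14] and [e32], corrected by multiples of
     [a2] and [w0]. *)
  split=> //; apply: (mulfI (mulf_neq0 n4 s0)); rewrite mulr0.
  rewrite XX zy wu' in e14 e32.
  apply: (lin_comb (add_eq (add_eq (mul_eq (- (p + r) * s) a2)
     (mul_eq (2 * (r * X - p * u)) w0))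
     (add_eq (mul_eq 2 e14) (mul_eq (- 2) e32)))); ring.
have npq : s * (s * (p - r) - c * (x + y)) != 0 by rewrite mulf_neq0 ?subr_eq0.
have pq : p - q = s * (s * (p - r) - c * (x + y)).
  by apply: (lin_comb (mul_eq (- p) cs)); rewrite /q; ring.
have rq : r - q' = - (s * (s * (p - r) - c * (x + y))).
  by apply: (lin_comb (mul_eq (- r) cs)); rewrite /q'; ring.
have ncs : c * s != 0 by rewrite mulf_neq0.
(* Since [r - q' = - (p - q)] is nonzero, the last factors of [e13] and [e24] cancel. *)
move/eqP: e13; rewrite pq mulf_eq0 (negPf npq) orbF mulf_eq0 => /orP e13.
move/eqP: e24; rewrite rq mulf_eq0 oppr_eq0 (negPf npq) orbF mulf_eq0 => /orP e24.
have fbE : w = u -> f - fb = s2 * (s2 * (f - h) - 2 * c2 * u).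
  by move=> wu'; apply: (lin_comb (mul_eq (- f) cs2)); rewrite /fb wu'; ring.
have hbE : w = u -> hb - h = s2 * (s2 * (f - h) - 2 * c2 * u).
  by move=> wu'; apply: (lin_comb (mul_eq h cs2)); rewrite /hb wu'; ring.
have [u0|nu] := eqVneq u 0.
  left; split=> //; have w0 := u0w u0.
  case: e24 => /eqP e24; last first.
    apply: (mulfI (mulf_neq0 c20 s20)); apply: (lin_comb (mul_eq (- 1) e24)).
    by rewrite /X u0 w0; ring.
  have ey : c * r = s * y by apply: (lin_comb e24); ring.
  have ex : c * r = s * x.
    have : (c * r)^* = (s * y)^* by rewrite ey.
    by rewrite !rmorphM /= cR sR yx conjCK (CrealP (ger0_real r_ge0)).
  apply: (mulfI (mulf_neq0 s20 s20)).
  have [r0|nr] := eqVneq r 0.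
    have x0 : x = 0 by apply: (mulfI s0); rewrite -ex r0 !mulr0.
    have y0 := x0y x0.
    have np : p != 0 by apply/eqP=> p0; apply: nsc; rewrite x0 p0 r0.
    have zE : z = - (c * s * p) by rewrite /z x0 y0 r0; ring.
    have nz : c * s * p != 0 by rewrite mulf_neq0.
    move/eqP: e34; rewrite zE mulf_eq0 oppr_eq0 (negPf nz) /= => /eqP e34.
    apply: (mulfI (mulf_neq0 c20 (mulf_neq0 (mulf_neq0 s0 s0) np))).
    apply: (lin_comb (add_eq e34 (mul_eq (- c2 * s ^+ 2 * p) (hbE (etrans w0 (esym u0)))))).
    by rewrite /q /q' x0 y0 r0 w0 u0; ring.
  have nx : x != 0.
    by apply/eqP=> x0; move/eqP: ex; rewrite x0 mulr0 mulf_eq0 (negPf c0) (negPf nr).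
  move/eqP: e12; rewrite mulf_eq0 (negPf nx) /= => /eqP e12.
  apply: (mulfI (mulf_neq0 c20 nr)).
  apply: (lin_comb (add_eq (mul_eq (- 1) e12) (mul_eq (- c2 * r) (fbE (etrans w0 (esym u0)))))).
  by rewrite u0; ring.
case: e13 => /eqP e13; last by rewrite e13 eqxx in nu.
exfalso; case: e24 => /eqP X0.
  have e13' : c * p + s * y = 0.
    have : (c * p + s * x)^* = 0 by rewrite e13 conjC0.
    by rewrite rmorphD !rmorphM /= cR sR yx (CrealP (ger0_real p_ge0)).
  (* A positive semidefinite matrix of trace zero vanishes, hence is scalar, against [nsc]. *)
  have pr0 : p + r = 0.
    by apply: (mulfI c0); rewrite mulr0; apply: (lin_comb (add_eq e13' X0)); ring.
  have p0 : p = 0 by apply/eqP; move/eqP: pr0; rewrite paddr_eq0 // => /andP[].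
  by apply: nsc; rewrite (herm_entries_p0 hE p0) p0; split=> //; rewrite -pr0 p0 add0r.
(* For [w = u], [X] is [- c2 * (s2 * (f - h) - 2 * c2 * u) - u]. The missing second premise comes
   from [e34] when [p = 0] and from [e12] otherwise. *)
have fin : w = u -> s2 * (f - h) - 2 * c2 * u = 0 -> False.
  move=> wu' hd; move/eqP: nu; apply.
  apply: (lin_comb (add_eq (mul_eq (- 1) X0) (add_eq (mul_eq (- c2) hd) (mul_eq (- u) cs2)))).
  by rewrite /X wu'; ring.
have [p0|np] := eqVneq p 0.
  have x0 : x = 0.
    by apply: (mulfI s0); apply: (lin_comb e13); rewrite p0; ring.
  have y0 := x0y x0.
  have nr : r != 0 by apply/eqP=> r0; apply: nsc; rewrite x0 p0 r0.
  have nz : c * s * r != 0 by rewrite mulf_neq0.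
  have zE : z = c * s * r by rewrite /z x0 y0 p0; ring.
  have zE' : z' = c * s * r by rewrite /z' x0 y0 p0; ring.
  move/eqP: e33; rewrite zE zE' !mulf_eq0 (negPf c0) (negPf s0) (negPf nr) /=.
  rewrite subr_eq0 => /eqP wu'; apply: (fin wu').
  move/eqP: e34; rewrite zE mulf_eq0 (negPf nz) /= => /eqP e34.
  have qE : q = s ^+ 2 * r by rewrite /q x0 y0 p0; ring.
  have b : c2 * h - s2 * w = c2 * hb.
    apply: (lin_comb (add_eq (mul_eq s2 X0) (mul_eq (s2 * u - c2 * h) cs2))).
    by rewrite /hb /X wu'; ring.
  apply: (mulfI (mulf_neq0 (mulf_neq0 c20 (mulf_neq0 (mulf_neq0 s0 s0) nr)) s20)).
  apply: (lin_comb (add_eq e34 (add_eq (mul_eq (q' - q) b)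
    (mul_eq (- c2 * q) (hbE wu'))))); rewrite qE; ring.
have nx : x != 0.
  by apply/eqP=> x0; move/eqP: e13; rewrite x0 mulr0 addr0 mulf_eq0 (negPf c0) (negPf np).
have ny : y != 0 by rewrite yx conjC_eq0.
have wu' : w = u.
  by apply: subr0_eq; apply: (mulfI (mulf_neq0 nx ny)); rewrite mulr0.
apply: (fin wu').
move/eqP: e12; rewrite mulf_eq0 (negPf nx) /= => /eqP e12.
have b : c2 * f + s2 * u = c2 * fb.
  apply: (lin_comb (add_eq (mul_eq (- s2) X0) (mul_eq (- (c2 * f + s2 * u)) cs2))).
  by rewrite /fb /X wu'; ring.
apply: (mulfI (mulf_neq0 (mulf_neq0 c20 np) s20)).
apply: (lin_comb (add_eq (mul_eq (- 1) e12) (add_eq (mul_eq (p - r) b)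
  (mul_eq (- c2 * p) (fbE wu'))))); ring.
Qed.

Hypothesis c2R : c2^* = c2.

(* The traceless parts of E and E' are opposite.  Positivity of t forces x to be
   real, and then E and E' have rank one and (p - r)^2 + 4 c2^2 p r = 0. *)
Lemma bob_bob_scalar p r x y f h u p' r' x' y' f' h' u' t :
  herm_entries p r x y -> herm_entries p' r' x' y' -> x != 0 ->
  0 < t -> x' = - t * x -> y' = - t * y -> p' - r' = - t * (p - r) ->
  ~ (u = 0 /\ f = h) -> ~ (u' = 0 /\ f' = h') ->
  let X := - c2 * s2 * (f - h) + c2 ^+ 2 * u - s2 ^+ 2 * u in
  let X' := - c2 * s2 * (f' - h') + c2 ^+ 2 * u' - s2 ^+ 2 * u' in
  s * (p - r) = c * (x + y) ->
  (p - r) * (X - u) = (p + r) * (X + u) ->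
  (p * r - x * y) * (X + u) = 0 ->
  (p' - r') * (X' - u') = (p' + r') * (X' + u') ->
  (p' * r' - x' * y') * (X' + u') = 0 ->
  (c * p + s * x) * (c * p' + s * y') * (u * u') =
  (c * p' + s * x') * (c * p + s * y) * (u * u') ->
  p * (c * p' + s * x') * u' * (f - h) = p' * (c * p + s * x) * u * (f' - h') ->
  False.
Proof.
move=> hE hE' nx t0 ex' ey' ed nF nF' X X' ed0 a2 a3 a2' a3' e11 e13.
have [p_ge0 r_ge0 yx _] := hE; have [p'_ge0 r'_ge0 _ _] := hE'.
have nt : t != 0 by rewrite gt_eqF.
have nx' : x' != 0 by rewrite ex' mulf_neq0 ?oppr_eq0.
have n2 : 2 != 0 :> C by rewrite pnatr_eq0.
have np : p != 0 by apply/eqP=> p0; move/eqP: nx; apply; apply: herm_entries_p0 hE p0.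
have nr : r != 0 by apply/eqP=> r0; move/eqP: nx; apply; apply: herm_entries_r0 hE r0.
have np' : p' != 0 by apply/eqP=> p0; move/eqP: nx'; apply; apply: herm_entries_p0 hE' p0.
have nr' : r' != 0 by apply/eqP=> r0; move/eqP: nx'; apply; apply: herm_entries_r0 hE' r0.
have rX : r * X = - p * u.
  by apply: (mulfI n2); apply: (lin_comb (mul_eq (- 1) a2)); ring.
have rX' : r' * X' = - p' * u'.
  by apply: (mulfI n2); apply: (lin_comb (mul_eq (- 1) a2')); ring.
have nu : u != 0.
  apply/eqP=> u0; apply: nF; split=> //.
  apply: (mulfI (mulf_neq0 nr (mulf_neq0 c20 s20))).
  by apply: (lin_comb (mul_eq (- 1) rX)); rewrite /X u0; ring.
have nu' : u' != 0.
  apply/eqP=> u0; apply: nF'; split=> //.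
  apply: (mulfI (mulf_neq0 nr' (mulf_neq0 c20 s20))).
  by apply: (lin_comb (mul_eq (- 1) rX')); rewrite /X' u0; ring.
have npt : p' + t * p != 0.
  by rewrite gt_eqF // ltr_wpDl // mulr_gt0 // lt_def np.
(* After substituting [ex'] and [ey'], [e11] becomes [c * s * (p' + t * p) * (x - y) * (u * u') =
   0]. *)
have xy : y = x.
  apply/esym/subr0_eq; apply: (mulfI (mulf_neq0 (mulf_neq0 (mulf_neq0 c0 s0) npt)
     (mulf_neq0 nu nu'))).
  by apply: (lin_comb e11); rewrite ex' ey'; ring.
have nd : p - r != 0.
  apply/eqP=> d0; move: ed0; rewrite d0 xy mulr0 => /esym/eqP.
  by rewrite mulf_eq0 (negPf c0) -mulr2n -mulr_natl mulf_eq0 (negPf n2) (negPf nx).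
have nd' : p' - r' != 0 by rewrite ed mulf_neq0 ?oppr_eq0.
have nXu (d g Y v : C) : d != 0 -> v != 0 -> d * (Y - v) = g * (Y + v) -> Y + v != 0.
  move=> d0 v0 e; apply/eqP=> Yv; move/eqP: v0; apply.
  apply: (mulfI (mulf_neq0 n2 d0)).
  by apply: (lin_comb (add_eq (mul_eq (- 1) e) (mul_eq (d - g) Yv))); ring.
have pr : p * r = x ^+ 2.
  apply: subr0_eq; apply: (mulIf (nXu _ _ _ _ nd nu a2)); rewrite mul0r -a3 xy; ring.
have pr' : p' * r' = x' ^+ 2.
  by apply: subr0_eq; apply: (mulIf (nXu _ _ _ _ nd' nu' a2'));
    rewrite mul0r -a3' ey' xy -ex'; ring.
have ed1 : s * (p - r) = 2 * c * x by rewrite ed0 xy; ring.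
(* As both determinants vanish, the square of each trace is the square of the diagonal difference
   plus four times that of the off-diagonal entry. The traces are nonnegative, so they are in ratio
   [t], and [E'] is [t] times the adjugate of [E]. *)
have sum' : p' + r' = t * (p + r).
  have : (p' + r') ^+ 2 == (t * (p + r)) ^+ 2.
    apply/eqP; apply: (lin_comb (add_eq (add_eq (mul_eq 4 pr') (mul_eq (- 4 * t ^+ 2) pr))
      (mul_eq (p' - r' - t * (p - r)) ed))); rewrite ex'; ring.
  rewrite eqrXn2 //; first by move/eqP.
    by rewrite addr_ge0.
  by rewrite mulr_ge0 ?(ltW t0) ?addr_ge0.
have p'E : p' = t * r.
  by apply: (mulfI n2); apply: (lin_comb (add_eq sum' ed)); ring.
have r'E : r' = t * p.
  by apply: (mulfI n2); apply: (lin_comb (add_eq sum' (mul_eq (- 1) ed))); ring.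
have nh : p + r != 0 by rewrite gt_eqF // ltr_wpDl // lt_def nr.
have cross : u' * (f - h) + u * (f' - h') = 0.
  apply: (mulfI (mulf_neq0 (mulf_neq0 nt nx) (mulf_neq0 s0 nh))).
  apply: (lin_comb (add_eq (mul_eq (- 2) e13)
   (add_eq (mul_eq (2 * c * t * (u' * (f - h) - u * (f' - h'))) pr)
     (mul_eq (- t * x * (u' * (f - h) - u * (f' - h'))) ed1)))).
  by rewrite ex' p'E; ring.
have rX1' : p * X' = - r * u'.
  by apply: (mulfI nt); apply: (lin_comb rX'); rewrite p'E r'E; ring.
(* Adding multiples of [rX] and [rX1'] lets [cross] eliminate [f - h] and [f' - h']. The resulting
   sum is positive because [p], [r] and [c2 ^+ 2] are. *)
have : (p - r) ^+ 2 + 4 * c2 ^+ 2 * (p * r) = 0.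
  apply: (mulfI (mulf_neq0 nu nu')).
  apply: (lin_comb (add_eq (mul_eq (c2 * s2 * p * r) cross)
     (add_eq (add_eq (mul_eq (p * u') rX) (mul_eq (r * u) rX1'))
             (mul_eq (2 * p * r * u * u') cs2)))).
  rewrite /X /X'; ring.
apply/eqP; rewrite gt_eqF // ltr_wpDl //.
  by rewrite real_exprn_even_ge0 // rpredB ?ger0_real.
have gt0 (a : C) : a != 0 -> 0 <= a -> 0 < a by rewrite lt_def => ->.
by rewrite mulr_gt0 // mulr_gt0 ?ltr0n ?real_sqr_gt0 ?gt0.
Qed.

Variables (c3 s3 : C).
Hypotheses (c30 : c3 != 0) (s30 : s3 != 0) (cs3 : c3 ^+ 2 + s3 ^+ 2 = 1).

(* Here the traceless part of E is a multiple of the Pauli matrix sigma_y, and the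
   premises reduce to t x^2 = p p' with x imaginary. *)
Lemma bob_charlie_scalar p r x y f h u p' r' x' y' g k v t :
  herm_entries p r x y -> herm_entries p' r' x' y' -> ~ (x = 0 /\ p = r) ->
  0 < t -> x' = - t * x -> y' = - t * y -> p' - r' = - t * (p - r) ->
  ~ (u = 0 /\ f = h) -> ~ (v = 0 /\ g = k) ->
  let X := - c2 * s2 * (f - h) + c2 ^+ 2 * u - s2 ^+ 2 * u in
  let Y := - c3 * s3 * (g - k) + c3 ^+ 2 * v - s3 ^+ 2 * v in
  let q' := c ^+ 2 * p' + c * s * (x' + y') + s ^+ 2 * r' in
  let z' := - c * s * (p - r) + c ^+ 2 * y - s ^+ 2 * x in
  s * (p - r) = c * (x + y) ->
  (p - r) * (X - u) = (p + r) * (X + u) ->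
  c * (p' - r') = - s * (x' + y') ->
  (p' - r') * (Y - v) = (p' + r') * (Y + v) ->
  x * (c2 * f + s2 * u) * c3 * ((c * y' + s * r') * s2 * Y) +
  (c * p + s * x) * u * - s3 *
     (q' * (s3 ^+ 2 * g - 2 * c3 * s3 * v + c3 ^+ 2 * k)) =
  p' * g * ((c * p + s * x) * u * - s3) +
  (- s * p' + c * x') * - s2 * v * (z' * (c2 * h - s2 * u) * c3) ->
  False.
Proof.
move=> hE hE' nsc t0 ex' ey' ed nF nG X Y q' z' b1 b2 g1 g2 e13.
have [p_ge0 r_ge0 yx _] := hE; have [p'_ge0 r'_ge0 _ _] := hE'.
have nt : t != 0 by rewrite gt_eqF.
have n2 : 2 != 0 :> C by rewrite pnatr_eq0.
(* With [d = p - r] and [e = x + y], the relations [b1] and [g1] read [s d = c e] and [c d = - s e];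
   eliminating [e] leaves [(c^2 + s^2) d = 0]. *)
have d0 : p - r = 0.
  rewrite ed ex' ey' in g1; apply: (mulfI nt).
  apply: (lin_comb (add_eq (mul_eq (- c) g1) (add_eq (mul_eq (t * s) b1)
     (mul_eq (- t * (p - r)) cs)))); ring.
have pr : r = p by apply/esym/subr0_eq.
have xy : y = - x.
  apply: (mulfI c0); apply: (lin_comb (mul_eq (-1) b1)); rewrite d0; ring.
have d0' : p' - r' = 0 by rewrite ed d0 mulr0.
have pr' : r' = p' by apply/esym/subr0_eq.
have xy' : y' = - x' by rewrite ey' xy ex'; ring.
have nx : x != 0 by apply/eqP=> x0; apply: nsc; rewrite x0 pr.
have nx' : x' != 0 by rewrite ex' mulf_neq0 ?oppr_eq0.
have np : p != 0 by apply/eqP=> p0; move/eqP: nx; apply; apply: herm_entries_p0 hE p0.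
have np' : p' != 0 by apply/eqP=> p0; move/eqP: nx'; apply; apply: herm_entries_p0 hE' p0.
have Xu : X = - u.
  apply: (mulfI (mulf_neq0 n2 np)); apply: (lin_comb (mul_eq (- 1) b2)); rewrite pr; ring.
have Yv : Y = - v.
  apply: (mulfI (mulf_neq0 n2 np')); apply: (lin_comb (mul_eq (- 1) g2)); rewrite pr'; ring.
have hd : s2 * (f - h) = 2 * c2 * u.
  apply: (mulfI c20); apply: (lin_comb (add_eq (mul_eq (- 1) Xu) (mul_eq (- u) cs2))).
  rewrite /X; ring.
have hg : s3 * (g - k) = 2 * c3 * v.
  apply: (mulfI c30); apply: (lin_comb (add_eq (mul_eq (- 1) Yv) (mul_eq (- v) cs3))).
  rewrite /Y; ring.
have nu : u != 0.
  apply/eqP=> u0; apply: nF; split=> //; apply: (mulfI s20); apply: (lin_comb hd).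
  by rewrite u0; ring.
have nv : v != 0.
  apply/eqP=> u0; apply: nG; split=> //; apply: (mulfI s30); apply: (lin_comb hg).
  by rewrite u0; ring.
have gE : s3 ^+ 2 * g - 2 * c3 * s3 * v + c3 ^+ 2 * k = k.
  by apply: (lin_comb (add_eq (mul_eq s3 hg) (mul_eq k cs3))); ring.
have qE : q' = p'.
  by apply: (lin_comb (mul_eq p' cs)); rewrite /q' pr' xy'; ring.
have zE : z' = - x.
  by apply: (lin_comb (mul_eq (- x) cs)); rewrite /z' d0 xy; ring.
rewrite gE qE Yv zE pr' xy' in e13.
have key : x * x' = - (p * p').
  apply: (mulfI (mulf_neq0 (mulf_neq0 n2 (mulf_neq0 c0 c30)) (mulf_neq0 nu nv))).
  apply: (lin_comb (add_eq e13 (add_eq (mul_eq (- p' * (c * p + s * x) * u) hg)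
    (add_eq (mul_eq (x * c3 * c2 * v * (s * p' - c * x')) hd)
     (mul_eq (2 * x * c3 * v * u * (s * p' - c * x')) cs2))))).
  ring.
move/eqP: nx; apply; apply/eqP; rewrite -normr_eq0 -sqrf_eq0.
have nxx : `|x| ^+ 2 = - x ^+ 2 by rewrite normCK -yx xy; ring.
have : t * `|x| ^+ 2 = - (p * p') by rewrite nxx -key ex'; ring.
move=> e; have : t * `|x| ^+ 2 <= 0 by rewrite e oppr_le0 mulr_ge0.
rewrite pmulr_rle0 // => le0; by rewrite eq_le le0 exprn_ge0.
Qed.

End Roles.
End Scalars.

(** * Gram matrices *)

Section Gram.
Variable C : numClosedFieldType.
Local Notation adj := (@adj C _ _).
Implicit Types E F G : 'M[C]_2.

Lemma sum2 (f : 'I_2 -> C) : \sum_k f k = f 0 + f 1.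
Proof.
rewrite !big_ord_recl big_ord0 addr0.
by congr (f _ + f _); apply: val_inj.
Qed.

Lemma ord2P (P : 'I_2 -> Prop) : P 0 -> P 1 -> forall i, P i.
Proof.
move=> P0 P1 [[|[|//]] lt_i].
- by rewrite (_ : Ordinal _ = 0) //; apply: val_inj.
- by rewrite (_ : Ordinal _ = 1) //; apply: val_inj.
Qed.

Definition psd E := exists X : 'M[C]_2, E = adj X *m X.
Definition scal E := E 0 1 = 0 /\ E 0 0 = E 1 1.

Lemma psd_entries E : psd E -> herm_entries (E 0 0) (E 1 1) (E 0 1) (E 1 0).
Proof.
move=> [X ->]; rewrite /herm_entries !mxE !sum2 !daggerE; split.
- by rewrite addr_ge0 // mulrC mul_conjC_ge0.
- by rewrite addr_ge0 // mulrC mul_conjC_ge0.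
- by rewrite rmorphD !rmorphM /= !conjCK; ring.
(* Here [a] is the determinant of [X], and that of [E] is its squared modulus. *)
- set a := X 0 0 * X 1 1 - X 0 1 * X 1 0.
  rewrite (_ : _ - _ = a * a^*) ?mul_conjC_ge0 //.
  by rewrite /a rmorphB !rmorphM /=; ring.
Qed.

Definition braket E (x y : 'cV[C]_2) := (adj x *m E *m y) 0 0.

(** The form [braket] in coordinates, without conjugates because the left vector is real wherever it
    is used. *)
Definition bil E (a b c d : C) :=
  a * c * E 0 0 + a * d * E 0 1 + b * c * E 1 0 + b * d * E 1 1.

Lemma qstateE (a b : C) : (qstate a b 0 0 = a) * (qstate a b 1 0 = b).
Proof. by rewrite !mxE /=; split; ring. Qed.

Lemma braket_qstate E a b c d : a^* = a -> b^* = b ->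
  braket E (qstate a b) (qstate c d) = bil E a b c d.
Proof.
move=> aR bR; rewrite /braket !mxE sum2 !mxE !sum2 !daggerE !qstateE aR bR /bil /=.
ring.
Qed.

Lemma bil1 a b c d : bil 1 a b c d = a * c + b * d.
Proof. by rewrite /bil !mxE /=; ring. Qed.

(* Coordinates of the local states: in S_1, ..., S_4 one party sees
   0, 1, A, A^perp, another one 0, B, 1, B^perp, the last one 0, C, C^perp, 1. *)
Definition la (c s : C) (i : 'I_4) := [:: 1; 0; c; - s]`_i.
Definition ma (c s : C) (i : 'I_4) := [:: 0; 1; s; c]`_i.
Definition lb (c s : C) (i : 'I_4) := [:: 1; c; 0; - s]`_i.
Definition mb (c s : C) (i : 'I_4) := [:: 0; s; 1; c]`_i.
Definition lc (c s : C) (i : 'I_4) := [:: 1; c; - s; 0]`_i.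
Definition mc (c s : C) (i : 'I_4) := [:: 0; s; c; 1]`_i.

Definition roleA c s i := qstate (la c s i) (ma c s i).
Definition roleB c s i := qstate (lb c s i) (mb c s i).
Definition roleC c s i := qstate (lc c s i) (mc c s i).

Definition i0 : 'I_4 := @Ordinal 4 0 isT.
Definition i1 : 'I_4 := @Ordinal 4 1 isT.
Definition i2 : 'I_4 := @Ordinal 4 2 isT.
Definition i3 : 'I_4 := @Ordinal 4 3 isT.

Lemma ord4P (P : 'I_4 -> Prop) : P i0 -> P i1 -> P i2 -> P i3 -> forall i, P i.
Proof.
move=> P0 P1 P2 P3 [[|[|[|[|//]]]] lt_i].
- by rewrite (_ : Ordinal _ = i0) //; apply: val_inj.
- by rewrite (_ : Ordinal _ = i1) //; apply: val_inj.
- by rewrite (_ : Ordinal _ = i2) //; apply: val_inj.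
- by rewrite (_ : Ordinal _ = i3) //; apply: val_inj.
Qed.

Lemma sum4 (f : 'I_4 -> C) : \sum_k f k = f i0 + f i1 + f i2 + f i3.
Proof.
rewrite !big_ord_recl big_ord0 addr0 !addrA.
by congr (f _ + f _ + f _ + f _); apply: val_inj.
Qed.

(** The compression of the product operator to the span of S_1, ..., S_4, with [E], [F], [G] listed
    by role instead of by party. *)
Definition gram3 (c1 s1 c2 s2 c3 s3 : C) E F G : 'M[C]_4 :=
  \matrix_(i, j) (braket E (roleA c1 s1 i) (roleA c1 s1 j) *
                  braket F (roleB c2 s2 i) (roleB c2 s2 j) *
                  braket G (roleC c3 s3 i) (roleC c3 s3 j)).

Definition trig (c s : C) :=
  [/\ c^* = c, s^* = s, c != 0, s != 0 & c ^+ 2 + s ^+ 2 = 1].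

(** * Consequences of commuting Gram matrices *)

Section Commute.
Variables c1 s1 c2 s2 c3 s3 : C.
Hypotheses (t1 : trig c1 s1) (t2 : trig c2 s2) (t3 : trig c3 s3).
Local Notation T := (gram3 c1 s1 c2 s2 c3 s3).

Lemma gram3E E F G i j : T E F G i j =
  bil E (la c1 s1 i) (ma c1 s1 i) (la c1 s1 j) (ma c1 s1 j) *
  bil F (lb c2 s2 i) (mb c2 s2 i) (lb c2 s2 j) (mb c2 s2 j) *
  bil G (lc c3 s3 i) (mc c3 s3 i) (lc c3 s3 j) (mc c3 s3 j).
Proof.
have [c1R s1R _ _ _] := t1; have [c2R s2R _ _ _] := t2.
have [c3R s3R _ _ _] := t3.
rewrite mxE /roleA /roleB /roleC !braket_qstate //; elim/ord4P: i;
  by rewrite /la /ma /lb /mb /lc /mc /= ?rmorphN /= ?conjC0 ?conjC1 ?c1R ?s1R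
     ?c2R ?s2R ?c3R ?s3R.
Qed.

Lemma comm4 (A B : 'M[C]_4) : A *m B = B *m A -> forall i j,
  A i i0 * B i0 j + A i i1 * B i1 j + A i i2 * B i2 j + A i i3 * B i3 j =
  B i i0 * A i0 j + B i i1 * A i1 j + B i i2 * A i2 j + B i i3 * A i3 j.
Proof. by move=> /matrixP AB i j; have := AB i j; rewrite !mxE !sum4. Qed.

Lemma trig_dot c s : trig c s ->
  (c * c + s * s = 1) * (- s * - s + c * c = 1) *
  (c * - s + s * c = 0) * (- s * c + c * s = 0).
Proof. by move=> [_ _ _ _ cs]; do ![split]; rewrite -?cs; ring. Qed.

(** Expands one entry of a matrix relation; most overlaps of the second and third roles are 0 or 1
    by orthonormality of [(c, s)] and [(- s, c)]. *)
Ltac entry H :=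
  have := H; rewrite !gram3E /la /ma /lb /mb /lc /mc /= !bil1
   !(mul0r, mulr0, mul1r, mulr1, add0r, addr0);
  rewrite ?(trig_dot t2) ?(trig_dot t3).

(** Eight entries of the commutator, freed of common sines and cosines, are the premises of
    [bob_scalar]; its first alternative contradicts that [F] is not scalar. *)
Lemma bob_commute E F : psd E -> psd F -> ~ scal E -> ~ scal F ->
  T E 1 1 *m T E F 1 = T E F 1 *m T E 1 1 ->
  let p := E 0 0 in let r := E 1 1 in let x := E 0 1 in let y := E 1 0 in
  let f := F 0 0 in let h := F 1 1 in let u := F 0 1 in
  let X := - c2 * s2 * (f - h) + c2 ^+ 2 * u - s2 ^+ 2 * u in
  [/\ s1 * (p - r) = c1 * (x + y), F 1 0 = u,
      (p - r) * (X - u) = (p + r) * (X + u) &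
      (p * r - x * y) * (X + u) = 0].
Proof.
move=> pE pF sE sF H p r x y f h u X.
have [c1R s1R n1 m1 cs1] := t1; have [c2R s2R n2 m2 cs2] := t2.
have [c3R s3R n3 m3 cs3] := t3.
have hE := psd_entries pE; have [_ _ wu _] := psd_entries pF.
have e i j := comm4 H i j.
case: (bob_scalar c1R s1R n1 m1 cs1 n2 m2 cs2 (f := f) (h := h) (u := u)
   (w := F 1 0) hE sE wu).
- entry (e i0 i0) => H0; apply: (mulfI (mulf_neq0 (mulf_neq0 n2 m2) (mulf_neq0 n3 n3))).
  by apply: (lin_comb H0); rewrite /bil -/p -/r -/x -/y -/f -/h -/u; ring.
- entry (e i2 i2) => H0; apply: (mulfI (mulf_neq0 (mulf_neq0 n2 m2) (mulf_neq0 n3 n3))).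
  by apply: (lin_comb H0); rewrite /bil -/p -/r -/x -/y -/f -/h -/u; ring.
- entry (e i0 i1) => H0; apply: (mulfI n3).
  by apply: (lin_comb H0); rewrite /bil -/p -/r -/x -/y -/f -/h -/u; ring.
- entry (e i2 i3) => H0; apply: (mulfI n3).
  by apply: (lin_comb H0); rewrite /bil -/p -/r -/x -/y -/f -/h -/u; ring.
- entry (e i0 i2) => H0; apply: (mulfI m3).
  by apply: (lin_comb (mul_eq (- 1) H0)); rewrite /bil -/p -/r -/x -/y -/f -/h -/u; ring.
- entry (e i1 i3) => H0; apply: (mulfI m3).
  by apply: (lin_comb H0); rewrite /bil -/p -/r -/x -/y -/f -/h -/u; ring.
- entry (e i0 i3) => H0; apply: (mulfI (mulf_neq0 (mulf_neq0 n2 n3) m3)).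
  by apply: (lin_comb H0); rewrite /bil -/p -/r -/x -/y -/f -/h -/u; ring.
- entry (e i2 i1) => H0; apply: (mulfI (mulf_neq0 (mulf_neq0 n2 n3) m3)).
  by apply: (lin_comb H0); rewrite /bil -/p -/r -/x -/y -/f -/h -/u; ring.
- by case=> u0 fh; case: sF.
move=> [a1 a2]; rewrite a2 => a3 a4; split=> //.
Qed.

(** Exchanging the second and third roles swaps S_3 with S_4, hence A with A^perp, so [bob_scalar]
    applies with [(- s1, c1)] in place of [(c1, s1)], up to signs. *)
Lemma charlie_commute E G : psd E -> psd G -> ~ scal E -> ~ scal G ->
  T E 1 1 *m T E 1 G = T E 1 G *m T E 1 1 ->
  let p := E 0 0 in let r := E 1 1 in let x := E 0 1 in let y := E 1 0 in
  let g := G 0 0 in let k := G 1 1 in let v := G 0 1 in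
  let Y := - c3 * s3 * (g - k) + c3 ^+ 2 * v - s3 ^+ 2 * v in
  [/\ c1 * (p - r) = - s1 * (x + y), G 1 0 = v &
      (p - r) * (Y - v) = (p + r) * (Y + v)].
Proof.
move=> pE pF sE sF H p r x y f h u X.
have [c1R s1R n1 m1 cs1] := t1; have [c2R s2R n2 m2 cs2] := t2.
have [c3R s3R n3 m3 cs3] := t3.
have hE := psd_entries pE; have [_ _ wu _] := psd_entries pF.
have e i j := comm4 H i j.
have s1R' : (- s1)^* = - s1 by rewrite rmorphN /= s1R.
have m1' : - s1 != 0 by rewrite oppr_eq0.
have cs1' : (- s1) ^+ 2 + c1 ^+ 2 = 1 by rewrite -cs1; ring.
case: (bob_scalar s1R' c1R m1' n1 cs1' n3 m3 cs3 (f := f) (h := h) (u := u)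
   (w := G 1 0) hE sE wu).
- entry (e i0 i0) => H0; apply: (mulfI (mulf_neq0 (mulf_neq0 n3 m3) (mulf_neq0 n2 n2))).
  rewrite /bil -/p -/r -/x -/y -/f -/h -/u in H0 *.
  by first [apply: (lin_comb H0); ring | apply: (lin_comb (mul_eq (- 1) H0)); ring].
- entry (e i3 i3) => H0; apply: (mulfI (mulf_neq0 (mulf_neq0 n3 m3) (mulf_neq0 n2 n2))).
  rewrite /bil -/p -/r -/x -/y -/f -/h -/u in H0 *.
  by first [apply: (lin_comb H0); ring | apply: (lin_comb (mul_eq (- 1) H0)); ring].
- entry (e i0 i1) => H0; apply: (mulfI n2).
  rewrite /bil -/p -/r -/x -/y -/f -/h -/u in H0 *.
  by first [apply: (lin_comb H0); ring | apply: (lin_comb (mul_eq (- 1) H0)); ring].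
- entry (e i3 i2) => H0; apply: (mulfI n2).
  rewrite /bil -/p -/r -/x -/y -/f -/h -/u in H0 *.
  by first [apply: (lin_comb H0); ring | apply: (lin_comb (mul_eq (- 1) H0)); ring].
- entry (e i0 i3) => H0; apply: (mulfI m2).
  rewrite /bil -/p -/r -/x -/y -/f -/h -/u in H0 *.
  by first [apply: (lin_comb H0); ring | apply: (lin_comb (mul_eq (- 1) H0)); ring].
- entry (e i1 i2) => H0; apply: (mulfI m2).
  rewrite /bil -/p -/r -/x -/y -/f -/h -/u in H0 *.
  by first [apply: (lin_comb H0); ring | apply: (lin_comb (mul_eq (- 1) H0)); ring].
- entry (e i0 i2) => H0; apply: (mulfI (mulf_neq0 (mulf_neq0 n2 n3) m2)).
  rewrite /bil -/p -/r -/x -/y -/f -/h -/u in H0 *.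
  by first [apply: (lin_comb H0); ring | apply: (lin_comb (mul_eq (- 1) H0)); ring].
- entry (e i3 i1) => H0; apply: (mulfI (mulf_neq0 (mulf_neq0 n2 n3) m2)).
  rewrite /bil -/p -/r -/x -/y -/f -/h -/u in H0 *.
  by first [apply: (lin_comb H0); ring | apply: (lin_comb (mul_eq (- 1) H0)); ring].
- by case=> u0 fh; case: sF.
by move=> [a1 a2]; rewrite a2 => a3 a4; split.
Qed.

(* The coordinate of E along E0 modulo scalar matrices, when E is a real affine
   combination of 1 and E0. *)
Definition tilt E0 E :=
  if E0 0 1 != 0 then E 0 1 / E0 0 1 else (E 0 0 - E 1 1) / (E0 0 0 - E0 1 1).

Lemma tiltD E0 E E' : tilt E0 (E + E') = tilt E0 E + tilt E0 E'.
Proof. by rewrite /tilt !mxE; case: ifP => _; ring. Qed.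

Lemma tilt_scalar E0 (a : C) : tilt E0 a%:M = 0.
Proof. by rewrite /tilt !mxE /= subrr !mul0r if_same. Qed.

(** Two entries of the commutator make the traceless parts of [E0] and [E] parallel, and hermiticity
    makes their ratio real. *)
Lemma tilt_commute E0 E : psd E0 -> psd E -> ~ scal E0 ->
  T E0 1 1 *m T E 1 1 = T E 1 1 *m T E0 1 1 ->
  let l := tilt E0 E in
  [/\ l^* = l, E 0 1 = l * E0 0 1, E 1 0 = l * E0 1 0
    & E 0 0 - E 1 1 = l * (E0 0 0 - E0 1 1)].
Proof.
move=> pE0 pE sE H /=.
have [c1R s1R n1 m1 cs1] := t1; have [c2R s2R n2 m2 cs2] := t2.
have [c3R s3R n3 m3 cs3] := t3.
have [p0 r0 yx _] := psd_entries pE0; have [p0' r0' yx' _] := psd_entries pE.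
have e i j := comm4 H i j.
have e00 : E0 0 1 * E 1 0 = E 0 1 * E0 1 0.
  entry (e i0 i0) => H0.
  apply: (mulfI (mulf_neq0 (mulf_neq0 n2 n3) (mulf_neq0 n2 n3))).
  by apply: (lin_comb H0); rewrite /bil; ring.
have e01 : (E0 0 0 - E0 1 1) * E 0 1 = (E 0 0 - E 1 1) * E0 0 1.
  entry (e i0 i1) => H0; apply: (mulfI (mulf_neq0 n2 n3)).
  by apply: (lin_comb H0); rewrite /bil; ring.
have pR a : 0 <= a -> a^* = a by move=> a0; apply/CrealP/ger0_real.
rewrite /tilt; case: ifPn => [nx|/negbNE/eqP x0].
  have ny : E0 1 0 != 0 by rewrite yx conjC_eq0.
  have lE : E 0 1 / E0 0 1 = E 1 0 / E0 1 0.
    by apply/eqP; rewrite eqr_div // -e00; apply/eqP; ring.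
  split; first by rewrite rmorphM fmorphV /= -yx -yx' lE.
  - by rewrite mulfVK.
  - by rewrite lE mulfVK.
  - by rewrite mulrAC -[_ * (_ - _)]mulrC e01 mulfK.
have nd : E0 0 0 - E0 1 1 != 0.
  by apply/eqP=> d0; apply: sE; split=> //; apply: subr0_eq.
have x0' : E 0 1 = 0 by apply: (mulfI nd); rewrite e01 x0 !mulr0.
split; last by rewrite mulfVK.
- by rewrite rmorphM fmorphV !rmorphB /= !pR.
- by rewrite x0' x0 mulr0.
- by rewrite yx yx' x0' x0 conjC0 mulr0.
Qed.

(** Each of S_1, S_2 is orthogonal to each of S_3, S_4 already in the second or third role. The four
    corresponding minors therefore add up to the squared trace of [E], which must vanish. *)
Lemma gram3_rank1 E : psd E ->
  (forall i j, T E 1 1 i i * T E 1 1 j j = T E 1 1 i j * T E 1 1 j i) ->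
  [/\ E 0 0 = 0, E 1 1 = 0 & E 0 1 = 0].
Proof.
move=> pE e.
have [c1R s1R n1 m1 cs1] := t1; have [c2R s2R n2 m2 cs2] := t2.
have [c3R s3R n3 m3 cs3] := t3.
have hE := psd_entries pE; have [p0 r0 _ _] := hE.
have : (E 0 0 + E 1 1) * (E 0 0 + E 1 1) = 0.
  entry (e i0 i2) => H02; entry (e i0 i3) => H03.
  entry (e i1 i2) => H12; entry (e i1 i3) => H13.
  apply: (lin_comb (add_eq (add_eq (add_eq H02 H03) (add_eq H12 H13))
     (mul_eq (- (E 0 0 + E 1 1) * (E 0 0 + E 1 1)) cs1))).
  by rewrite /bil; ring.
move/eqP; rewrite mulf_eq0 orbb paddr_eq0 // => /andP[/eqP p00 /eqP r00].
by split=> //; apply: herm_entries_p0 hE p00.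
Qed.

Lemma scal_opposite E E' t : ~ scal E -> 0 < t -> E' 0 1 = - t * E 0 1 ->
  E' 0 0 - E' 1 1 = - t * (E 0 0 - E 1 1) -> ~ scal E'.
Proof.
move=> sE t0 ex ed [x0 d0]; apply: sE.
have nt : - t != 0 by rewrite oppr_eq0 gt_eqF.
split; first by apply: (mulfI nt); rewrite -ex x0 mulr0.
by apply: subr0_eq; apply: (mulfI nt); rewrite -ed d0 subrr mulr0.
Qed.

Lemma bob_bob_commute E F E' F' t :
  psd E -> psd F -> psd E' -> psd F' -> ~ scal E -> ~ scal F -> ~ scal F' ->
  0 < t -> E' 0 1 = - t * E 0 1 -> E' 1 0 = - t * E 1 0 ->
  E' 0 0 - E' 1 1 = - t * (E 0 0 - E 1 1) ->
  T E 1 1 *m T E F 1 = T E F 1 *m T E 1 1 ->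
  T E' 1 1 *m T E' F' 1 = T E' F' 1 *m T E' 1 1 ->
  T E F 1 *m T E' F' 1 = T E' F' 1 *m T E F 1 -> False.
Proof.
move=> pE pF pE' pF' sE sF sF' t0 ex ey ed H H' HH.
have [c1R s1R n1 m1 cs1] := t1; have [c2R s2R n2 m2 cs2] := t2.
have [c3R s3R n3 m3 cs3] := t3.
have sE' := scal_opposite sE t0 ex ed.
have [b1 b2 b3 b4] := bob_commute pE pF sE sF H.
have [b1' b2' b3' b4'] := bob_commute pE' pF' sE' sF' H'.
have hE := psd_entries pE; have hE' := psd_entries pE'.
have nx : E 0 1 != 0.
  apply/eqP=> x0; apply: sE; split=> //.
  have [_ _ yx _] := hE; apply: subr0_eq; apply: (mulfI m1).
  by rewrite b1 yx x0 conjC0; ring.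
have e i j := comm4 HH i j.
have qE (p r x y : C) : s1 * (p - r) = c1 * (x + y) ->
    c1 ^+ 2 * p + c1 * s1 * (x + y) + s1 ^+ 2 * r = p.
  move=> b; apply: (lin_comb (add_eq (mul_eq (- s1) b) (mul_eq p cs1))); ring.
apply: (bob_bob_scalar n1 m1 n2 m2 cs2 c2R hE hE' nx t0 ex ey ed sF sF'
   b1 b3 b4 b3' b4').
- entry (e i0 i0) => H0; apply: (mulfI (mulf_neq0 m3 m3)).
  by apply: (lin_comb H0); rewrite /bil b2 b2' ex ey; ring.
- entry (e i0 i2) => H0; apply: (mulfI m3).
  apply: (lin_comb (add_eq (mul_eq (- 1) H0) (add_eq
    (mul_eq (s3 * (c1 * E' 0 0 + s1 * E' 0 1) * F' 0 1 * F 1 1) (qE _ _ _ _ b1))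
    (mul_eq (- s3 * (c1 * E 0 0 + s1 * E 0 1) * F 0 1 * F' 1 1)
       (qE _ _ _ _ b1'))))); by rewrite /bil; ring.
Qed.

Lemma bob_charlie_commute E F E' G t :
  psd E -> psd F -> psd E' -> psd G -> ~ scal E -> ~ scal F -> ~ scal G ->
  0 < t -> E' 0 1 = - t * E 0 1 -> E' 1 0 = - t * E 1 0 ->
  E' 0 0 - E' 1 1 = - t * (E 0 0 - E 1 1) ->
  T E 1 1 *m T E F 1 = T E F 1 *m T E 1 1 ->
  T E' 1 1 *m T E' 1 G = T E' 1 G *m T E' 1 1 ->
  T E F 1 *m T E' 1 G = T E' 1 G *m T E F 1 -> False.
Proof.
move=> pE pF pE' pF' sE sF sF' t0 ex ey ed H H' HH.
have [c1R s1R n1 m1 cs1] := t1; have [c2R s2R n2 m2 cs2] := t2.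
have [c3R s3R n3 m3 cs3] := t3.
have sE' := scal_opposite sE t0 ex ed.
have [b1 b2 b3 b4] := bob_commute pE pF sE sF H.
have [b1' b2' b3'] := charlie_commute pE' pF' sE' sF' H'.
have hE := psd_entries pE; have hE' := psd_entries pE'.
have e i j := comm4 HH i j.
apply: (bob_charlie_scalar n1 cs1 n2 m2 cs2 n3 m3 cs3 hE hE' sE t0 ex ey ed
   sF sF' b1 b3 b1' b3').
by entry (e i0 i2) => H0; apply: (lin_comb H0); rewrite /bil b2 b2'; ring.
Qed.

End Commute.
End Gram.

(** * LOCC protocols *)

Section ListIn.
Variables (I : Type).
Implicit Types s : seq I.

(** Membership is [List.In] because subprotocols carry no [eqType] structure. *)
Lemma eq_big_In (V : nmodType) s (F G : I -> V) :
  (forall x, List.In x s -> F x = G x) -> \sum_(x <- s) F x = \sum_(x <- s) G x.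
Proof.
elim: s => [|a s IHs] FG; first by rewrite !big_nil.
rewrite !big_cons FG; last by left.
by rewrite IHs // => x xs; apply: FG; right.
Qed.

Lemma In_exVall (P : I -> bool) s :
  (exists2 x, List.In x s & P x) \/ (forall x, List.In x s -> ~~ P x).
Proof.
elim: s => [|a s [[x xs Px]|IHs]]; first by right.
  by left; exists x => //; right.
case Pa: (P a); first by left; exists a => //; left.
by right=> x [<-|/IHs//]; rewrite Pa.
Qed.

Lemma sum_In_neq0 (V : nmodType) s (F : I -> V) :
  \sum_(x <- s) F x != 0 -> exists2 x, List.In x s & F x != 0.
Proof.
have [//|F0] := In_exVall (fun x => F x != 0) s.
rewrite (eq_big_In (G := fun=> 0)) ?big1_eq ?eqxx // => x /F0.
by rewrite negbK => /eqP.
Qed.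

Variable R : numDomainType.

Lemma sum_In_gt0 s (F : I -> R) : (forall x, List.In x s -> F x \is Num.real) ->
  0 < \sum_(x <- s) F x -> exists2 x, List.In x s & 0 < F x.
Proof.
move=> FR; have [//|F0] := In_exVall (fun x => 0 < F x) s.
suff : \sum_(x <- s) F x <= 0 by move=> /le_lt_trans h /h; rewrite ltxx.
elim: s FR F0 => [|a s IHs] FR F0; first by rewrite big_nil.
rewrite big_cons -[leRHS]addr0; apply: lerD.
  by rewrite real_leNgt ?real0 ?FR ?F0 //; left.
by apply: IHs => x xs; [apply: FR|apply: F0]; right.
Qed.

Lemma sum_In_lt0 s (F : I -> R) a : (forall x, List.In x s -> F x \is Num.real) ->
  \sum_(x <- s) F x = 0 -> List.In a s -> 0 < F a ->
  exists2 x, List.In x s & F x < 0.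
Proof.
move=> FR sum0 sa Fa; have [//|F0] := In_exVall (fun x => F x < 0) s.
have F_ge0 x : List.In x s -> 0 <= F x.
  by move=> xs; rewrite real_leNgt ?real0 ?FR ?F0.
suff : 0 < \sum_(x <- s) F x by rewrite sum0 ltxx.
elim: s sa F_ge0 {FR sum0 F0} => [//|b s IHs] /= sa F_ge0; rewrite big_cons.
have sum_ge0 l : (forall x, List.In x l -> 0 <= F x) -> 0 <= \sum_(x <- l) F x.
  elim: l => [|d l IHl] l0; first by rewrite big_nil.
  by rewrite big_cons addr_ge0 ?l0 ?IHl //; [left|move=> x xl; apply: l0; right].
case: sa => [->|sa].
  by rewrite ltr_pwDl // sum_ge0 // => x xs; apply: F_ge0; right.
rewrite ltr_wpDl //; first by apply: F_ge0; left.
by apply: IHs => // x xs; apply: F_ge0; right.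
Qed.

End ListIn.

Section Locc.
Variable C : numClosedFieldType.
Local Notation adj := (@adj C _ _).
Local Notation locc := (locc C).
Implicit Types (t : locc) (p q : 'I_3) (K : 'M[C]_2) (ks : seq ('M[C]_2 * locc)).

(** Subtrees sit inside a list, so induction needs a hypothesis for every member of that list. *)
Lemma locc_nested_ind (P : locc -> Prop) :
  (forall g, P (Leaf C g)) ->
  (forall p ks, (forall kt, List.In kt ks -> P kt.2) -> P (Node p ks)) ->
  forall t, P t.
Proof.
move=> Pleaf Pnode; fix IH 1 => -[g|p ks]; first exact: Pleaf.
apply: Pnode; elim: ks => [kt []|[K t] ks IHks kt /= [<-|]]; first exact: (IH t).
exact: IHks.
Qed.

Lemma locc_valid_node p ks : locc_valid (Node p ks) ->
  \sum_(x <- ks) adj x.1 *m x.1 = 1%:M /\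
  forall kt, List.In kt ks -> locc_valid kt.2.
Proof.
move=> [sum1 val_ks]; split=> //.
elim: ks {sum1} val_ks => [//|[K t] ks IHks] /= [vt vks] kt [<- //|].
exact: IHks.
Qed.

Lemma locc_leaves_node p ks : locc_leaves (Node p ks) =
  flatten [seq [seq (x.1 *m local_op p kt.1, x.2) | x <- locc_leaves kt.2]
          | kt <- ks].
Proof. by rewrite /=; elim: ks => [//|[K t] ks IHks] /=; rewrite IHks. Qed.

Lemma local_opD p K K' : local_op p (K + K') = local_op p K + local_op p K'.
Proof.
by rewrite /local_op; do 2?case: ifP => _; apply/matrixP=> i j; rewrite !mxE; ring.
Qed.

Lemma local_op0 p : local_op p 0 = 0 :> 'M[C]_8.
Proof.
by rewrite /local_op; do 2?case: ifP => _; apply/matrixP=> i j; rewrite !mxE; ring.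
Qed.

Lemma local_op1 p : local_op p 1%:M = 1%:M :> 'M[C]_8.
Proof. by rewrite /local_op; do 2?case: ifP => _; apply: kron3_1. Qed.

Lemma local_op_sqr p K :
  adj (local_op p K) *m local_op p K = local_op p (adj K *m K).
Proof.
have one : adj (1 : 'M[C]_2) *m (1 : 'M[C]_2) = 1 by rewrite dagger1 mul1mx.
by rewrite /local_op; do 2?case: ifP => _; rewrite adj_kron3 kron3M one.
Qed.

Lemma local_op_sum p (I : Type) (s : seq I) (F : I -> 'M[C]_2) :
  local_op p (\sum_(x <- s) F x) = \sum_(x <- s) local_op p (F x).
Proof.
by elim: s => [|a s IHs]; rewrite ?big_nil ?local_op0 // !big_cons local_opD IHs.
Qed.

(** The identity obtained by induction for a subtree is inserted between the two copies of the Kraus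
    operator leading to it. *)
Lemma locc_complete t : locc_valid t ->
  \sum_(x <- locc_leaves t) adj x.1 *m x.1 = 1%:M.
Proof.
elim/locc_nested_ind: t => [g|p ks IH] vt.
  by rewrite /= big_seq1 dagger1 mul1mx.
have [sum1 vks] := locc_valid_node vt.
rewrite locc_leaves_node big_flatten big_map -(local_op1 p) -sum1 local_op_sum.
apply: eq_big_In => kt kt_ks; rewrite big_map /=.
rewrite -local_op_sqr -[X in _ = _ *m X]mul1mx.
rewrite -[in RHS](IH _ kt_ks (vks _ kt_ks)) mulmx_suml mulmx_sumr.
by apply: eq_bigr => x _; rewrite daggerM !mulmxA.
Qed.

(* V holds the unnormalised states that reach the root of t. *)
Definition discriminates k t (V : 'M[C]_(8, k)) :=
  forall x, x \in locc_leaves t -> forall j : 'I_k,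
    x.2 != j -> x.1 *m col j V = 0.

Lemma discriminates_node k p ks (V : 'M[C]_(8, k)) kt :
  discriminates (Node p ks) V -> List.In kt ks ->
  discriminates kt.2 (local_op p kt.1 *m V).
Proof.
move=> dV kt_ks x x_kt j xj; rewrite colE !mulmxA -mulmxA -colE.
apply: (dV (x.1 *m local_op p kt.1, x.2)) => //; rewrite locc_leaves_node.
elim: ks kt_ks {dV} => [//|a ks IHks] /= [->|kt_ks]; rewrite mem_cat.
  by rewrite (map_f (fun x => (x.1 *m local_op p kt.1, x.2)) x_kt).
by rewrite IHks ?orbT.
Qed.

(** By completeness the inner product of two columns is a sum over leaves, and each leaf annihilates
    at least one of the two. *)
Lemma discriminates_orthogonal k t (V : 'M[C]_(8, k)) :
  locc_valid t -> discriminates t V ->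
  forall i j, i != j -> (adj V *m V) i j = 0.
Proof.
move=> vt dV i j ij.
rewrite -[X in adj V *m X]mul1mx -(locc_complete vt) mulmx_suml mulmx_sumr summxE.
rewrite big1_seq // => x /andP[_ xt].
rewrite -mulmxA mulmxA -daggerM mxE big1 // => l _; rewrite daggerE.
have col0 (m : 'I_k) : x.2 != m -> (x.1 *m V) l m = 0.
  by move=> xm; have /colP/(_ l) := dV x xt m xm; rewrite colE mulmxA -colE !mxE.
have [xi|xi] := eqVneq x.2 (i : nat).
  by rewrite (col0 j) ?mulr0 // xi; apply: contraNneq ij => /val_inj ->.
by rewrite (col0 i) ?conjC0 ?mul0r.
Qed.

(** All leaf probabilities on column [j] add up to 1, and so do those of the leaves announcing [j];
    every other leaf has probability zero. *)
Lemma distinguishable_discriminates k (B : 'M[C]_(8, k)) :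
  adj B *m B = 1%:M -> locc_distinguishable B ->
  exists2 t, locc_valid t & discriminates t B.
Proof.
move=> BB [t [vt pt]]; exists t => // x xt j xj; apply: sqnorm_eq0.
have all1 : \sum_(x <- locc_leaves t) sqnorm (x.1 *m col j B) = 1.
  have -> : 1 = (adj (col j B) *m (1%:M *m col j B)) 0 0.
    rewrite mul1mx; have /matrixP/(_ j j) := BB; rewrite !mxE eqxx mulr1n => <-.
    by apply: eq_bigr => l _; rewrite !mxE.
  rewrite -(locc_complete vt) mulmx_suml mulmx_sumr summxE.
  by apply: eq_bigr => y _; rewrite sqnormE daggerM !mulmxA.
move: all1; rewrite (bigID (fun x : 'M[C]_8 * nat => x.2 == j)) /= pt.
move/(canRL (addKr _)); rewrite addNr => rest0.
have : sqnorm (x.1 *m col j B) <= 0.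
  rewrite -rest0 (big_rem x) //= xj lerDl.
  by apply: sumr_ge0 => y _; apply: sqnorm_ge0.
by move=> le0; apply/eqP; rewrite eq_le le0 sqnorm_ge0.
Qed.

Definition o0 : 'I_3 := @Ordinal 3 0 isT.
Definition o1 : 'I_3 := @Ordinal 3 1 isT.
Definition o2 : 'I_3 := @Ordinal 3 2 isT.

Lemma ord3P (P : 'I_3 -> Prop) : P o0 -> P o1 -> P o2 -> forall p, P p.
Proof.
move=> P0 P1 P2 [[|[|[|//]]] lt_i].
- by rewrite (_ : Ordinal _ = o0) //; apply: val_inj.
- by rewrite (_ : Ordinal _ = o1) //; apply: val_inj.
- by rewrite (_ : Ordinal _ = o2) //; apply: val_inj.
Qed.

Implicit Types X E : 'I_3 -> 'M[C]_2.

Definition tens E := kron3 (E o0) (E o1) (E o2).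
Definition idop : 'I_3 -> 'M[C]_2 := fun=> 1.
Definition upd E p A : 'I_3 -> 'M[C]_2 := fun q => if q == p then A else E q.
Definition sqr_op X p := adj (X p) *m X p.

Lemma tens_idop : tens idop = 1%:M.
Proof. exact: kron3_1. Qed.

Lemma upd_eq E p A : upd E p A p = A. Proof. by rewrite /upd eqxx. Qed.

Lemma upd_neq E p A q : q != p -> upd E p A q = E q.
Proof. by rewrite /upd => /negPf ->. Qed.

Lemma local_op_tens p K X :
  local_op p K *m tens X = tens (upd X p (K *m X p)).
Proof.
by elim/ord3P: p; rewrite /local_op /tens /upd /= kron3M !mul1mx.
Qed.

Lemma tens_sqr X : adj (tens X) *m tens X = tens (sqr_op X).
Proof. by rewrite /tens adj_kron3 kron3M. Qed.

Lemma tens_scale E E' :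
  (forall q, exists2 a : C, a != 0 & E q = a *: E' q) ->
  exists2 a : C, a != 0 & tens E = a *: tens E'.
Proof.
move=> sc; have [a0 na0 e0] := sc o0; have [a1 na1 e1] := sc o1.
have [a2 na2 e2] := sc o2; exists (a0 * a1 * a2); first by rewrite !mulf_neq0.
by rewrite /tens e0 e1 e2 kron3Z.
Qed.

Lemma scal_mx (A : 'M[C]_2) : psd A -> scal A -> A = A 0 0 *: 1.
Proof.
move=> pA [x0 d0]; have [_ _ yx _] := psd_entries pA.
have y0 : A 1 0 = 0 by rewrite yx x0 conjC0.
apply/matrixP; elim/ord2P; elim/ord2P; rewrite !mxE /= ?mulr1 ?mulr0 //.
Qed.

Lemma psd_sqr (A : 'M[C]_2) : psd (adj A *m A). Proof. by exists A. Qed.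

Section Basis.
Variables (k : nat) (B : 'M[C]_(8, k)).

Definition gramB E : 'M[C]_k := adj B *m tens E *m B.
Definition diagB E := forall i j, i != j -> gramB E i j = 0.
(** The index [g] is a natural number because a leaf may announce a number that labels no state;
    then the whole matrix vanishes. *)
Definition rank1B E := exists g : nat, forall i j : 'I_k,
  (g != i) || (g != j) -> gramB E i j = 0.

Lemma gramB_sqr X : gramB (sqr_op X) = adj (tens X *m B) *m (tens X *m B).
Proof. by rewrite /gramB -tens_sqr daggerM !mulmxA. Qed.

Lemma gramB_scale E E' : (forall q, exists2 a : C, a != 0 & E q = a *: E' q) ->
  exists2 a : C, a != 0 & gramB E = a *: gramB E'.
Proof.
by move=> /tens_scale[a na e]; exists a; rewrite // /gramB e -scalemxAr -scalemxAl.
Qed.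

Lemma diagB_scale E E' : (forall q, exists2 a : C, a != 0 & E q = a *: E' q) ->
  diagB E -> diagB E'.
Proof.
move=> /gramB_scale[a na e] dE i j ij; apply: (mulfI na).
by have := dE i j ij; rewrite e mxE mulr0.
Qed.

Lemma rank1B_scale E E' : (forall q, exists2 a : C, a != 0 & E q = a *: E' q) ->
  rank1B E -> rank1B E'.
Proof.
move=> /gramB_scale[a na e] [g dE]; exists g => i j ij; apply: (mulfI na).
by have := dE i j ij; rewrite e mxE mulr0.
Qed.

Lemma discriminates_diagB t X : locc_valid t -> discriminates t (tens X *m B) ->
  diagB (sqr_op X).
Proof.
move=> vt dX i j ij; rewrite gramB_sqr.
exact: discriminates_orthogonal vt dX i j ij.
Qed.

Lemma discriminates_leaf g X : discriminates (Leaf C g) (tens X *m B) ->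
  rank1B (sqr_op X).
Proof.
move=> dX; exists g => i j ij; rewrite gramB_sqr mxE big1 // => l _.
have col0 (m : 'I_k) : g != m -> (tens X *m B) l m = 0.
  move=> gm; have /colP/(_ l) := dX (1%:M, g) (mem_head _ _) m gm.
  by rewrite mul1mx [X in X = _ -> _]mxE => ->; rewrite mxE.
rewrite daggerE; case/orP: ij => gi; first by rewrite (col0 i) ?conjC0 ?mul0r.
by rewrite (col0 j) ?mulr0.
Qed.

Lemma discriminates_child p ks X kt :
  discriminates (Node p ks) (tens X *m B) -> List.In kt ks ->
  discriminates kt.2 (tens (upd X p (kt.1 *m X p)) *m B).
Proof.
by move=> dX kt_ks; rewrite -local_op_tens -mulmxA; apply: discriminates_node dX _.
Qed.

Lemma sum_sqr_children p ks X : locc_valid (Node p ks) ->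
  \sum_(x <- ks) adj (x.1 *m X p) *m (x.1 *m X p) = sqr_op X p.
Proof.
move=> /locc_valid_node[sum1 _].
rewrite /sqr_op -[X in _ *m X]mul1mx -sum1 mulmx_suml mulmx_sumr.
by apply: eq_bigr => x _; rewrite daggerM !mulmxA.
Qed.

End Basis.
End Locc.

(** * Following a protocol along chosen outcomes *)

Section Path.
Variable C : numClosedFieldType.
Local Notation adj := (@adj C _ _).
Variables (k : nat) (B : 'M[C]_(8, k)).
Local Notation diagB := (diagB B).
Local Notation idop := (idop C).
Implicit Types (X : 'I_3 -> 'M[C]_2) (A E F : 'M[C]_2).

Lemma scalP A : reflect (scal A) ((A 0 1 == 0) && (A 0 0 == A 1 1)).
Proof. by apply: (iffP andP) => -[/eqP ? /eqP ?]. Qed.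

Definition op1 p E := upd idop p E.
Definition op2 p E q F := upd (op1 p E) q F.

Definition trivial_at X q := exists2 a : C, a != 0 & sqr_op X q = a *: 1.

Lemma sqr_upd_eq X p A : sqr_op (upd X p A) p = adj A *m A.
Proof. by rewrite /sqr_op upd_eq. Qed.

Lemma sqr_upd_neq X p A q : q != p -> sqr_op (upd X p A) q = sqr_op X q.
Proof. by move=> qp; rewrite /sqr_op upd_neq. Qed.

(** Parties that have acted trivially contribute nonzero scalars, to which [diagB] and [rank1B] are
    insensitive, so their operators may be replaced by 1. *)
Lemma op1_scale X p : (forall q, q != p -> trivial_at X q) ->
  forall q, exists2 a : C, a != 0 & sqr_op X q = a *: op1 p (sqr_op X p) q.
Proof.
move=> triv q; have [->|qp] := eqVneq q p.
  by exists 1; rewrite ?oner_eq0 // scale1r /op1 upd_eq.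
by have [a na e] := triv q qp; exists a; rewrite // e /op1 upd_neq.
Qed.

Lemma op2_scale X p q : q != p -> (forall r, r != p -> r != q -> trivial_at X r) ->
  forall r, exists2 a : C, a != 0 &
    sqr_op X r = a *: op2 p (sqr_op X p) q (sqr_op X q) r.
Proof.
move=> qp triv r; have [->|rq] := eqVneq r q.
  by exists 1; rewrite ?oner_eq0 // scale1r /op2 upd_eq.
rewrite /op2 upd_neq //; have [->|rp] := eqVneq r p.
  by exists 1; rewrite ?oner_eq0 // scale1r /op1 upd_eq.
by have [a na e] := triv r rp rq; exists a; rewrite // e /op1 upd_neq.
Qed.

(** The scalar outcomes add up to [a != 0], so one of them is nonzero. *)
Lemma trivial_child p ks X : locc_valid (Node p ks) -> trivial_at X p ->
  (forall x, List.In x ks -> scal (adj (x.1 *m X p) *m (x.1 *m X p))) ->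
  exists2 x, List.In x ks & trivial_at (upd X p (x.1 *m X p)) p.
Proof.
move=> vt [a na e] sc.
have /sum_In_neq0[x xks nx] : \sum_(x <- ks) (adj (x.1 *m X p) *m (x.1 *m X p)) 0 0 != 0.
  by rewrite -summxE (sum_sqr_children X vt) e !mxE /= mulr1.
exists x => //; exists ((adj (x.1 *m X p) *m (x.1 *m X p)) 0 0) => //.
by rewrite sqr_upd_eq; apply: scal_mx (psd_sqr _) (sc x xks).
Qed.

(** The moment at which a party [q] other than [p] obtains a nonscalar [F]: the states are
    orthogonal before it, with [E] alone, and after it, with [E] and [F]. *)
Definition next_action p (l : 'M[C]_2 -> C) := exists q E F,
  [/\ q != p, psd E, psd F, 0 < l E & ~ scal F] /\
  (diagB (op1 p E) /\ diagB (op2 p E q F)).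

(* Among the outcomes of p the values of l add up, so a path along which l stays
   positive can be followed until another party acts nontrivially. *)
Lemma next_actionP p (l : 'M[C]_2 -> C) :
  l 0 = 0 -> {morph l : x y / x + y} ->
  (forall E, psd E -> diagB (op1 p E) -> l E \is Num.real) ->
  (forall E, psd E -> rank1B B (op1 p E) -> l E = 0) ->
  forall t X, locc_valid t -> discriminates t (tens X *m B) ->
    (forall q, q != p -> trivial_at X q) -> 0 < l (sqr_op X p) ->
  next_action p l.
Proof.
move=> l0 lD l_real l_leaf t.
have l_sum (s : seq ('M[C]_2 * locc C)) (G : 'M[C]_2 * locc C -> 'M[C]_2) :
    l (\sum_(x <- s) G x) = \sum_(x <- s) l (G x).
  by elim: s => [|a s IHs]; rewrite ?big_nil // !big_cons lD IHs.
elim/locc_nested_ind: t => [g|p0 ks IH] X vt dX triv lX.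
  move: lX; rewrite l_leaf ?ltxx //; first exact: psd_sqr.
  exact: rank1B_scale (op1_scale triv) (discriminates_leaf dX).
have [sum1 vks] := locc_valid_node vt.
have dchild x : List.In x ks ->
    discriminates x.2 (tens (upd X p0 (x.1 *m X p0)) *m B).
  by move=> xks; apply: discriminates_child dX xks.
have [p0p|pp0] := eqVneq p0 p.
  rewrite {p0}p0p in vt dX dchild *.
  have triv_child (x : 'M[C]_2 * locc C) q : q != p -> trivial_at (upd X p (x.1 *m X p)) q.
    by move=> qp; have [a na e] := triv q qp; exists a; rewrite // sqr_upd_neq.
  have [x xks lx] : exists2 x, List.In x ks & 0 < l (adj (x.1 *m X p) *m (x.1 *m X p)).
    apply: sum_In_gt0; last by rewrite -l_sum (sum_sqr_children X vt).
    move=> x xks; apply: l_real; first exact: psd_sqr.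
    rewrite -(sqr_upd_eq X p).
    apply: diagB_scale (op1_scale (triv_child x)) _.
    by apply: discriminates_diagB (dchild x xks); apply: vks.
  apply: (IH x xks _ (vks _ xks) (dchild x xks)); first exact: triv_child.
  by rewrite sqr_upd_eq.
(* Another party acts: a nonscalar outcome is the action sought; if there is none, the path
   continues through an outcome that is a nonzero scalar. *)
have [[x xks]|sc] := In_exVall (fun x : 'M[C]_2 * locc C =>
  let A := adj (x.1 *m X p0) *m (x.1 *m X p0) in
  ~~ ((A 0 1 == 0) && (A 0 0 == A 1 1))) ks.
  set A := adj _ *m _; move=> /= /scalP nsc.
  set X' := upd X p0 (x.1 *m X p0).
  have XA : sqr_op X' p0 = A by rewrite sqr_upd_eq.
  have XE : sqr_op X' p = sqr_op X p by rewrite sqr_upd_neq // eq_sym.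
  have dX' := discriminates_diagB (vks _ xks) (dchild x xks).
  exists p0, (sqr_op X p), A; split; first by split=> //; apply: psd_sqr.
  split.
    apply: diagB_scale (op1_scale triv) _.
    exact: discriminates_diagB vt dX.
  rewrite -XA -XE; apply: diagB_scale (op2_scale pp0 _) dX'.
  move=> r rp rp0; have [a na e] := triv r rp.
  by exists a; rewrite // sqr_upd_neq.
have [x xks tx] : exists2 x, List.In x ks & trivial_at (upd X p0 (x.1 *m X p0)) p0.
  apply: (trivial_child vt (triv _ pp0)) => x /sc /=.
  by rewrite negbK => /scalP.
apply: (IH x xks _ (vks _ xks) (dchild x xks)).
  move=> q qp; have [->//|qp0] := eqVneq q p0.
  by have [a na e] := triv q qp; exists a; rewrite // sqr_upd_neq.
by rewrite sqr_upd_neq // eq_sym.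
Qed.

(** Trivial measurements are skipped until some [p] has a nonscalar outcome, which serves as [E0]. A
    protocol without such a measurement would end in a leaf whose compression is that of the
    identity up to a scalar, which [rank] forbids. *)
Lemma two_next_actions :
  (forall p E0 E, psd E0 -> psd E -> ~ scal E0 -> diagB (op1 p E0) ->
     diagB (op1 p E) -> tilt E0 E \is Num.real) ->
  (forall p E, psd E -> rank1B B (op1 p E) ->
     [/\ E 0 0 = 0, E 1 1 = 0 & E 0 1 = 0]) ->
  forall t X, locc_valid t -> discriminates t (tens X *m B) ->
    (forall q, trivial_at X q) ->
  exists p E0, [/\ psd E0, ~ scal E0, diagB (op1 p E0),
    next_action p (tilt E0) & next_action p (fun E => - tilt E0 E)].
Proof.
move=> real_tilt rank t.
elim/locc_nested_ind: t => [g|p ks IH] X vt dX triv.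
  exfalso; have [a na e] := triv o0.
  have [] := rank o0 (sqr_op X o0) (psd_sqr _).
    exact: rank1B_scale (op1_scale (fun q _ => triv q)) (discriminates_leaf dX).
  by rewrite e !mxE /= mulr1 => a0; rewrite a0 eqxx in na.
have [sum1 vks] := locc_valid_node vt.
have dchild x : List.In x ks ->
    discriminates x.2 (tens (upd X p (x.1 *m X p)) *m B).
  by move=> xks; apply: discriminates_child dX xks.
have triv_child (x : 'M[C]_2 * locc C) q : q != p -> trivial_at (upd X p (x.1 *m X p)) q.
  by move=> qp; have [a na e] := triv q; exists a; rewrite // sqr_upd_neq.
have [[x xks]|sc] := In_exVall (fun x : 'M[C]_2 * locc C =>
  let A := adj (x.1 *m X p) *m (x.1 *m X p) in
  ~~ ((A 0 1 == 0) && (A 0 0 == A 1 1))) ks; last first.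
  have [x xks tx] : exists2 x, List.In x ks & trivial_at (upd X p (x.1 *m X p)) p.
    apply: (trivial_child vt (triv p)) => x /sc /=.
    by rewrite negbK => /scalP.
  apply: (IH x xks _ (vks _ xks) (dchild x xks)) => q.
  by have [->//|qp] := eqVneq q p; apply: triv_child.
pose A (x : 'M[C]_2 * locc C) := adj (x.1 *m X p) *m (x.1 *m X p).
move=> /= /scalP; rewrite -/(A x) => nsc.
have pA y : psd (A y) by apply: psd_sqr.
have dA y : List.In y ks -> diagB (op1 p (A y)).
  move=> yks; rewrite /A -(sqr_upd_eq X p).
  apply: diagB_scale (op1_scale (triv_child y)) _.
  by apply: discriminates_diagB (dchild y yks); apply: vks.
have rA y : List.In y ks -> tilt (A x) (A y) \is Num.real.
  by move=> yks; apply: (real_tilt p) => //; apply: dA.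
have tilt0 : tilt (A x) 0 = 0 by rewrite -(tilt_scalar (A x) 0) raddf0.
have tilt_leaf E : psd E -> rank1B B (op1 p E) -> tilt (A x) E = 0.
  move=> pE /(rank _ _ pE)[p0 r0 x0].
  by rewrite /tilt p0 r0 x0 subrr !mul0r if_same.
have tilt_x : tilt (A x) (A x) = 1.
  rewrite /tilt; case: ifPn => [nx|/negbNE/eqP x0]; first by rewrite divff.
  rewrite divff // subr_eq0; apply/eqP=> d0; exact: nsc.
(* The tilts of all outcomes add up to the tilt of a scalar matrix, which is 0, while that of [x]
   itself is 1. *)
have [y yks ry] : exists2 y, List.In y ks & tilt (A x) (A y) < 0.
  apply: (sum_In_lt0 (a := x)) => //; last by rewrite tilt_x ltr01.
  have -> : \sum_(y <- ks) tilt (A x) (A y) = tilt (A x) (\sum_(y <- ks) A y).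
    elim: (ks) => [|a s IHs]; first by rewrite !big_nil tilt0.
    by rewrite !big_cons tiltD IHs.
  have [a na e] := triv p; rewrite (sum_sqr_children X vt) e.
  by rewrite -[1]/(1%:M) scale_scalar_mx tilt_scalar.
exists p, (A x); split=> //; first exact: dA.
  apply: (next_actionP _ _ _ tilt_leaf (vks _ xks) (dchild x xks)) => //.
  - exact: tiltD.
  - by move=> E pE dE; apply: (real_tilt p) => //; apply: dA.
  - exact: triv_child.
  - by rewrite sqr_upd_eq -/(A x) tilt_x ltr01.
apply: (next_actionP _ _ _ _ (vks _ yks) (dchild y yks)) => //.
- by rewrite tilt0 oppr0.
- by move=> E E'; rewrite tiltD opprD.
- by move=> E pE dE; rewrite rpredN; apply: (real_tilt p) => //; apply: dA.
- by move=> E pE rE; rewrite tilt_leaf ?oppr0.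
- exact: triv_child.
- by rewrite sqr_upd_eq -/(A y) oppr_gt0.
Qed.

End Path.

(** * Bases of the subspace *)

Section Frames.
Variable C : numClosedFieldType.
Local Notation adj := (@adj C _ _).

Section ChangeOfBasis.
Variables (k : nat) (B : 'M[C]_(8, k)) (S : 'M[C]_(8, 4)).
Hypotheses (BB : adj B *m B = 1%:M) (SS : adj S *m S = 1%:M).
Hypothesis BS : (B^T == S^T)%MS.

(** Each of [S] and [B] is the other times a coefficient matrix, and orthonormality identifies these
    matrices as mutually adjoint. The number [k] of columns is not fixed in advance. *)
Lemma span_eq_unitary :
  exists2 W : 'M[C]_(k, 4), S = B *m W & W *m adj W = 1%:M.
Proof.
case/andP: BS => /submxP[Z eB] /submxP[W eS].
have {}eS : S = B *m W^T by rewrite -[LHS]trmxK eS trmx_mul trmxK.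
have {}eB : B = S *m Z^T by rewrite -[LHS]trmxK eB trmx_mul trmxK.
exists W^T => //.
have eZ : adj W^T = Z^T.
  have : adj S *m B = Z^T by rewrite eB mulmxA SS mul1mx.
  by rewrite eS daggerM -mulmxA BB mulmx1.
by rewrite eZ -(mul1mx (W^T)) -BB -(mulmxA _ B) -eS -mulmxA -eB.
Qed.

(** Both compressions have the form [W^dagger D W]; as [W W^dagger = 1], they multiply like the
    diagonal matrices [D]. *)
Lemma diagB_commute E E' : diagB B E -> diagB B E' ->
  (adj S *m tens E *m S) *m (adj S *m tens E' *m S) =
  (adj S *m tens E' *m S) *m (adj S *m tens E *m S).
Proof.
have [W -> WW] := span_eq_unitary; move=> dE dE'.
have conjW (F F' : 'I_3 -> 'M[C]_2) :
    (adj (B *m W) *m tens F *m (B *m W)) *m (adj (B *m W) *m tens F' *m (B *m W)) =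
    adj W *m (gramB B F *m gramB B F') *m W.
  rewrite daggerM /gramB !mulmxA -(mulmxA _ W (adj W)) WW mulmx1.
  by [].
rewrite !conjW; congr (_ *m _ *m _); apply/matrixP=> i j; rewrite !mxE.
have diag (F F' : 'I_3 -> 'M[C]_2) : diagB B F ->
    \sum_l gramB B F i l * gramB B F' l j = gramB B F i i * gramB B F' i j.
  move=> dF; rewrite (bigD1 i) //= big1 ?addr0 // => l li.
  by rewrite dF ?mul0r // eq_sym.
rewrite !diag //; have [->|ij] := eqVneq i j; first by rewrite mulrC.
by rewrite (dE i j) // (dE' i j) // !mulr0.
Qed.

(** The compression is [W^dagger D W] where [D] has at most one nonzero entry, so it has rank at
    most one and its minors vanish. *)
Lemma rank1B_minors E : rank1B B E -> let M := adj S *m tens E *m S in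
  forall i j, M i i * M j j = M i j * M j i.
Proof.
have [W -> _] := span_eq_unitary; move=> [g rE] M.
have ME i j : M i j = \sum_l (W l i)^* * (\sum_m gramB B E l m * W m j).
  rewrite /M daggerM !mulmxA -[_ *m B *m W]mulmxA -!mulmxA mxE.
  apply: eq_bigr => l _; rewrite daggerE; congr (_ * _).
  by rewrite !mulmxA -/(gramB B E) mxE.
(* If the announced number is out of range, the compression is zero. *)
have [gk|gk] := ltnP g k; last first.
  have M0 i j : M i j = 0.
    rewrite ME big1 // => l _; rewrite big1 ?mulr0 // => m _.
    by rewrite rE ?mul0r // gtn_eqF // (leq_trans (ltn_ord l) gk).
  by move=> i j; rewrite !M0.
have {}ME i j : M i j = (W (Ordinal gk) i)^* *
    (gramB B E (Ordinal gk) (Ordinal gk) * W (Ordinal gk) j).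
  have neq (l : 'I_k) : l != Ordinal gk -> g != l.
    by apply: contraNneq => gl; apply/eqP/val_inj; rewrite /= gl.
  have row0 (l : 'I_k) : l != Ordinal gk ->
      (W l i)^* * (\sum_m gramB B E l m * W m j) = 0.
    by move=> /neq lg; rewrite big1 ?mulr0 // => m _; rewrite rE ?lg ?mul0r.
  have col0 (l : 'I_k) : l != Ordinal gk ->
      gramB B E (Ordinal gk) l * W l j = 0.
    by move=> /neq lg; rewrite rE ?lg ?orbT ?mul0r.
  rewrite ME (bigD1 (Ordinal gk)) //= [X in _ + X]big1 // addr0.
  by rewrite (bigD1 (Ordinal gk)) //= [X in _ + X]big1 // addr0.
by move=> i j; rewrite !ME; ring.
Qed.

End ChangeOfBasis.

(* Relabelling S_2, S_3, S_4 realises every assignment of the three roles to the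
   parties, at the price of replacing (c, s) by (-s, c). *)
Definition frame (S : 'M[C]_(8, 4)) (p q r : 'I_3) := exists c1 s1 c2 s2 c3 s3 : C,
  [/\ trig c1 s1, trig c2 s2 & trig c3 s3] /\ exists2 S' : 'M[C]_(8, 4),
    (S'^T == S^T)%MS & forall E, adj S' *m tens E *m S' =
      gram3 c1 s1 c2 s2 c3 s3 (E p) (E q) (E r).

Definition prod_states (w : 'I_3 -> 'I_4 -> 'cV[C]_2) : 'M[C]_(8, 4) :=
  \matrix_(i, j) ket3 (w o0 j) (w o1 j) (w o2 j) i 0.

Lemma col_prod_states w j : col j (prod_states w) = ket3 (w o0 j) (w o1 j) (w o2 j).
Proof. by apply/colP=> i; rewrite !mxE. Qed.

Lemma prod_states_gram w E i j :
  (adj (prod_states w) *m tens E *m prod_states w) i j =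
  braket (E o0) (w o0 i) (w o0 j) * braket (E o1) (w o1 i) (w o1 j) *
  braket (E o2) (w o2 i) (w o2 j).
Proof.
have -> : (adj (prod_states w) *m tens E *m prod_states w) i j =
    (adj (col i (prod_states w)) *m (tens E *m col j (prod_states w))) 0 0.
  rewrite -mulmxA !mxE; apply: eq_bigr => l _; rewrite !daggerE !mxE.
  by congr (_ * _); apply: eq_bigr => m _; rewrite !mxE.
by rewrite !col_prod_states kron3_ket3 ket3_dot /braket !mulmxA.
Qed.

Lemma span_eq_monomial (S S' : 'M[C]_(8, 4)) (f : 'I_4 -> 'I_4) (a : 'I_4 -> C) :
  injective f -> (forall j, a j != 0) ->
  (forall j, col (f j) S = a j *: col j S') -> (S'^T == S^T)%MS.
Proof.
move=> f_inj na e; apply/andP; split; apply/row_subP=> j.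
  have -> : row j S'^T = (a j)^-1 *: row (f j) S^T.
    by rewrite -!tr_col e linearZ scalerA mulVf ?scale1r.
  by rewrite scalemx_sub ?row_sub.
by rewrite -(f_invF f_inj j) -tr_col e linearZ /= scalemx_sub // tr_col row_sub.
Qed.

End Frames.

(** * Impossibility of LOCC discrimination *)

Section Impossible.
Variable C : numClosedFieldType.
Local Notation adj := (@adj C _ _).

Lemma trig_perp (c s : C) : trig c s -> trig (- s) c.
Proof.
move=> [cR sR nc ns cs]; split=> //; rewrite ?oppr_eq0 //.
  by rewrite rmorphN /= sR.
by rewrite sqrrN addrC.
Qed.

Lemma gram3_1 (c1 s1 c2 s2 c3 s3 : C) : trig c1 s1 -> trig c2 s2 -> trig c3 s3 ->
  gram3 c1 s1 c2 s2 c3 s3 1 1 1 = 1%:M.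
Proof.
move=> tr1 tr2 tr3; apply/matrixP=> i j; rewrite gram3E // [RHS]mxE !bil1.
elim/ord4P: i; elim/ord4P: j; rewrite /la /ma /lb /mb /lc /mc /=;
rewrite !(mul0r, mulr0, mul1r, mulr1, add0r, addr0) ?(trig_dot tr1)
    ?(trig_dot tr2) ?(trig_dot tr3) ?(mul0r, mulr0, mulr1) //.
Qed.

Section States.
Variables (c1 s1 c2 s2 c3 s3 a b d : C).
Hypotheses (t1 : trig c1 s1) (t2 : trig c2 s2) (t3 : trig c3 s3).
Hypotheses (na : a != 0) (nb : b != 0) (nd : d != 0).

Let S := Smat (qstate c1 s1) (a *: qstate (- s1) c1)
              (qstate c2 s2) (b *: qstate (- s2) c2)
              (qstate c3 s3) (d *: qstate (- s3) c3).

(** The list [f] tells which column of [S] becomes the j-th state after relabelling, and [e] holds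
    the scalar between the two. *)
Lemma frame_intro p q r x1 y1 x2 y2 x3 y3 (w : 'I_3 -> 'I_4 -> 'cV[C]_2)
    (f : seq 'I_4) (e : seq C) :
  trig x1 y1 -> trig x2 y2 -> trig x3 y3 ->
  [&& p != q, q != r & p != r] ->
  w p = roleA x1 y1 -> w q = roleB x2 y2 -> w r = roleC x3 y3 ->
  uniq f -> size f = 4 -> all (fun u => u != 0) e -> size e = 4 ->
  (forall j : 'I_4, col (nth i0 f j) S = e`_j *: col j (prod_states w)) ->
  frame S p q r.
Proof.
move=> h1 h2 h3 pqr wp wq wr uf sf ne se cols.
exists x1, y1, x2, y2, x3, y3; split=> //; exists (prod_states w).
  apply: (@span_eq_monomial _ _ _ (fun j => nth i0 f j) (fun j => e`_j)) => //.
    move=> i j /eqP; rewrite nth_uniq ?sf ?ltn_ord // => /eqP; exact: val_inj.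
  by move=> j; apply: (all_nthP 0 ne); rewrite se.
move=> E; apply/matrixP=> i j; rewrite prod_states_gram mxE -wp -wq -wr.
by elim/ord3P: p pqr {wp}; elim/ord3P: q {wq}; elim/ord3P: r {wr} => //= _; ring.
Qed.

Definition by_party (w0 w1 w2 : 'I_4 -> 'cV[C]_2) (p : 'I_3) :=
  if p == o0 then w0 else if p == o1 then w1 else w2.

Lemma frameP p q r : p != q -> q != r -> p != r -> frame S p q r.
Proof.
have t1' := trig_perp t1; have t2' := trig_perp t2; have t3' := trig_perp t3.
have nab : a * b != 0 by rewrite mulf_neq0.
have nd' : - d != 0 by rewrite oppr_eq0.
have n1 : 1 != 0 :> C by rewrite oner_eq0.
have n1' : - 1 != 0 :> C by rewrite oppr_eq0.
elim/ord3P: p; elim/ord3P: q; elim/ord3P: r => // _ _ _.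
(* Six assignments of roles. A party whose state and orthogonal state trade places gets [(- s, c)],
   whose own orthogonal vector is [(- c, - s)]; hence the minus signs, which cancel when two such
   vectors meet. *)
- apply: (@frame_intro o0 o1 o2 c1 s1 c2 s2 c3 s3
    (by_party (roleA c1 s1) (roleB c2 s2) (roleC c3 s3))
    [:: i0; i1; i2; i3] [:: 1; 1; d; a * b]) => //.
    by rewrite /= ?n1 ?n1' ?nd ?nd' ?nab.
  by elim/ord4P; apply/colP=> i; rewrite col_prod_states !mxE /= /la /ma /lb /mb /lc /mc /=; ring.
- apply: (@frame_intro o0 o2 o1 (- s1) c1 c3 s3 c2 s2
    (by_party (roleA (- s1) c1) (roleC c2 s2) (roleB c3 s3))
    [:: i0; i1; i3; i2] [:: 1; 1; a * b; - d]) => //.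
    by rewrite /= ?n1 ?n1' ?nd ?nd' ?nab.
  by elim/ord4P; apply/colP=> i; rewrite col_prod_states !mxE /= /la /ma /lb /mb /lc /mc /=; ring.
- apply: (@frame_intro o1 o0 o2 c2 s2 c1 s1 (- s3) c3
    (by_party (roleB c1 s1) (roleA c2 s2) (roleC (- s3) c3))
    [:: i0; i2; i1; i3] [:: 1; d; - 1; a * b]) => //.
    by rewrite /= ?n1 ?n1' ?nd ?nd' ?nab.
  by elim/ord4P; apply/colP=> i; rewrite col_prod_states !mxE /= /la /ma /lb /mb /lc /mc /=; ring.
- apply: (@frame_intro o1 o2 o0 (- s2) c2 (- s3) c3 c1 s1
    (by_party (roleC c1 s1) (roleA (- s2) c2) (roleB (- s3) c3))
    [:: i0; i2; i3; i1] [:: 1; d; a * b; 1]) => //.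
    by rewrite /= ?n1 ?n1' ?nd ?nd' ?nab.
  by elim/ord4P; apply/colP=> i; rewrite col_prod_states !mxE /= /la /ma /lb /mb /lc /mc /=; ring.
- apply: (@frame_intro o2 o0 o1 c3 s3 (- s1) c1 (- s2) c2
    (by_party (roleB (- s1) c1) (roleC (- s2) c2) (roleA c3 s3))
    [:: i0; i3; i1; i2] [:: 1; a * b; - 1; - d]) => //.
    by rewrite /= ?n1 ?n1' ?nd ?nd' ?nab.
  by elim/ord4P; apply/colP=> i; rewrite col_prod_states !mxE /= /la /ma /lb /mb /lc /mc /=; ring.
- apply: (@frame_intro o2 o1 o0 (- s3) c3 (- s2) c2 (- s1) c1
    (by_party (roleC (- s1) c1) (roleB (- s2) c2) (roleA (- s3) c3))
    [:: i0; i3; i2; i1] [:: 1; a * b; - d; 1]) => //.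
    by rewrite /= ?n1 ?n1' ?nd ?nd' ?nab.
  by elim/ord4P; apply/colP=> i; rewrite col_prod_states !mxE /= /la /ma /lb /mb /lc /mc /=; ring.
Qed.

Lemma third_party (p q : 'I_3) : q != p -> exists2 r, q != r & p != r.
Proof.
elim/ord3P: p; elim/ord3P: q => // _;
  by [exists o0 | exists o1 | exists o2].
Qed.

Variables (k : nat) (B : 'M[C]_(8, k)).
Hypothesis basisB : orthonormal_basis_of S B.

(** At the identity operators the Gram matrix of the frame is 1, so [S'] is orthonormal and can be
    compared with [B]. *)
Lemma frame_commute p q r : frame S p q r -> exists x1 y1 x2 y2 x3 y3 : C,
  [/\ trig x1 y1, trig x2 y2 & trig x3 y3] /\
  let T E := gram3 x1 y1 x2 y2 x3 y3 (E p) (E q) (E r) in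
  (forall E E', diagB B E -> diagB B E' -> T E *m T E' = T E' *m T E) /\
  (forall E, rank1B B E -> forall i j, T E i i * T E j j = T E i j * T E j i).
Proof.
case: basisB => BB BS.
move=> [x1 [y1 [x2 [y2 [x3 [y3 [tr [S' S'S gram]]]]]]]].
exists x1, y1, x2, y2, x3, y3; split=> // T.
have BS' : (B^T == S'^T)%MS.
  apply/eqmxP; apply: eqmx_trans (eqmxP BS) _; apply/eqmx_sym/eqmxP/S'S.
have SS : adj S' *m S' = 1%:M.
  have := gram (idop C); rewrite tens_idop mulmx1 => ->.
  by case: tr => tr1 tr2 tr3; apply: gram3_1.
split=> [E E' dE dE'|E rE i j]; rewrite /T -(gram E).
  by rewrite -(gram E'); apply: (diagB_commute BB SS BS' dE dE').
exact: (rank1B_minors BB SS BS' rE).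
Qed.

Lemma op1_at (p q : 'I_3) (E : 'M[C]_2) :
  op1 p E q = if q == p then E else 1.
Proof. by []. Qed.

Lemma not_locc_distinguishable : ~ locc_distinguishable B.
Proof.
case: (basisB) => BB BS; move=> /(distinguishable_discriminates BB)[t vt dB].
have frame_at p : exists q r, [/\ p != q, q != r, p != r & frame S p q r].
  elim/ord3P: p.
  - by exists o1, o2; split=> //; apply: frameP.
  - by exists o0, o2; split=> //; apply: frameP.
  - by exists o0, o1; split=> //; apply: frameP.
have tiltP p E0 E : psd E0 -> psd E -> ~ scal E0 ->
    diagB B (op1 p E0) -> diagB B (op1 p E) -> let l := tilt E0 E in
    [/\ l^* = l, E 0 1 = l * E0 0 1, E 1 0 = l * E0 1 0
      & E 0 0 - E 1 1 = l * (E0 0 0 - E0 1 1)].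
  move=> pE0 pE nE0 dE0 dE.
  have [q [r [pq qr pr /frame_commute]]] := frame_at p.
  move=> [x1 [y1 [x2 [y2 [x3 [y3 [[tr1 tr2 tr3] /= [comm _]]]]]]]].
  apply: (tilt_commute tr1 tr2 tr3) => //.
  have := comm _ _ dE0 dE; rewrite !op1_at eqxx.
  by rewrite ![_ == p]eq_sym (negPf pq) (negPf pr).
have rankP p E : psd E -> rank1B B (op1 p E) ->
    [/\ E 0 0 = 0, E 1 1 = 0 & E 0 1 = 0].
  move=> pE rE; have [q [r [pq qr pr /frame_commute]]] := frame_at p.
  move=> [x1 [y1 [x2 [y2 [x3 [y3 [[tr1 tr2 tr3] /= [_ rank]]]]]]]].
  apply: (gram3_rank1 tr1 tr2 tr3) => // i j.
  have := rank _ rE i j; rewrite !op1_at eqxx.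
  by rewrite ![_ == p]eq_sym (negPf pq) (negPf pr).
have [||||p [E0 [pE0 nE0 dE0 up down]]] :=
    @two_next_actions _ _ B _ _ t (idop C) vt.
- move=> p E0 E pE0 pE nE0 dE0 dE; apply/CrealP.
  by have [] := tiltP p E0 E pE0 pE nE0 dE0 dE.
- exact: rankP.
- by rewrite tens_idop mul1mx.
- by move=> q; exists 1; rewrite ?oner_eq0 // /sqr_op dagger1 mul1mx scale1r.
move: up down => [q [E [F [[qp pE pF lE nF] [dE dEF]]]]].
move=> [q' [E' [F' [[qp' pE' pF' lE' nF'] [dE' dEF']]]]].
have [_ ex ey ed] := tiltP p E0 E pE0 pE nE0 dE0 dE.
have [_ ex' ey' ed'] := tiltP p E0 E' pE0 pE' nE0 dE0 dE'.
move: (tilt E0 E) (tilt E0 E') lE lE' ex ey ed ex' ey' ed' => l l' l0 l0'.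
move=> ex ey ed ex' ey' ed'.
have nl : l != 0 by rewrite gt_eqF.
(* Since [l] and [- l'] are positive, the traceless part of [E'] is that of [E] times the negative
   number [- u]. *)
pose u := - l' / l; have u0 : 0 < u by rewrite divr_gt0.
have fx : E' 0 1 = - u * E 0 1 by rewrite ex ex' /u; field.
have fy : E' 1 0 = - u * E 1 0 by rewrite ey ey' /u; field.
have fd : E' 0 0 - E' 1 1 = - u * (E 0 0 - E 1 1) by rewrite ed ed' /u; field.
have nE : ~ scal E.
  move=> [x0 d0]; apply: nE0; split; first by apply: (mulfI nl); rewrite -ex x0 mulr0.
  by apply: subr0_eq; apply: (mulfI nl); rewrite -ed d0 subrr mulr0.
(* The two next actions belong to the same party, which then takes the second role, or to two
   parties, which take the second and third. *)
have [qq|qq] := eqVneq q' q.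
  rewrite {q'}qq in qp' dEF'; have [r qr pr] := third_party qp.
  have pq : p != q by rewrite eq_sym.
  have [x1 [y1 [x2 [y2 [x3 [y3 [[tr1 tr2 tr3] /= [comm _]]]]]]]] :=
    frame_commute (frameP pq qr pr).
  have := comm _ _ dEF dEF'; have := comm _ _ dE' dEF'; have := comm _ _ dE dEF.
  have rp : r != p by rewrite eq_sym.
  have rq : r != q by rewrite eq_sym.
  rewrite /op2 /op1 /upd !eqxx (negPf pq) (negPf qp) (negPf rp) (negPf rq).
  exact: (bob_bob_commute tr1 tr2 tr3 pE pF pE' pF' nE nF nF' u0 fx fy fd).
have pq : p != q by rewrite eq_sym.
have pq' : p != q' by rewrite eq_sym.
have qq' : q != q' by rewrite eq_sym.
have [x1 [y1 [x2 [y2 [x3 [y3 [[tr1 tr2 tr3] /= [comm _]]]]]]]] :=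
  frame_commute (frameP pq qq' pq').
have := comm _ _ dEF dEF'; have := comm _ _ dE' dEF'; have := comm _ _ dE dEF.
rewrite /op2 /op1 /upd !eqxx (negPf pq) (negPf pq') (negPf qp) (negPf qp').
rewrite (negPf qq) (negPf qq').
exact: (bob_charlie_commute tr1 tr2 tr3 pE pF pE' pF' nE nF nF' u0 fx fy fd).
Qed.

End States.
End Impossible.

(** * Separable measurement *)

Section Separable.
Variable C : numClosedFieldType.
Local Notation adj := (@adj C _ _).

Definition unit_pair (v : C * C) := [/\ v.1^* = v.1, v.2^* = v.2 & v.1 ^+ 2 + v.2 ^+ 2 = 1].
Definition proj (v : C * C) : 'M[C]_2 := qstate v.1 v.2 *m adj (qstate v.1 v.2).

Lemma qstate_dot (v w : C * C) : v.1^* = v.1 -> v.2^* = v.2 ->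
  adj (qstate v.1 v.2) *m qstate w.1 w.2 = (v.1 * w.1 + v.2 * w.2)%:M.
Proof.
move=> R1 R2; rewrite [LHS]mx11_scalar; congr _%:M.
by rewrite !mxE sum2 !daggerE !qstateE R1 R2.
Qed.

Lemma proj_sqr v : unit_pair v -> adj (proj v) *m proj v = proj v.
Proof.
move=> [R1 R2 n]; rewrite /proj daggerM daggerK -mulmxA (mulmxA (adj _)).
by rewrite qstate_dot // -!expr2 n mul1mx.
Qed.

Lemma proj_qstate v x y : unit_pair v ->
  proj v *m qstate x y = (v.1 * x + v.2 * y) *: qstate v.1 v.2.
Proof.
move=> [R1 R2 _]; rewrite /proj -mulmxA (qstate_dot (x, y)) //.
by rewrite mul_mx_scalar.
Qed.

Lemma proj_compl c s : c^* = c -> s^* = s -> c ^+ 2 + s ^+ 2 = 1 ->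
  proj (c, s) + proj (- s, c) = 1.
Proof.
move=> cR sR cs; apply/matrixP; elim/ord2P; elim/ord2P;
  rewrite !mxE !big_ord1 !daggerE !qstateE ?rmorphN /= cR sR -?cs; ring.
Qed.

Variables (c1 s1 c2 s2 c3 s3 a b d : C).
Hypotheses (t1 : trig c1 s1) (t2 : trig c2 s2) (t3 : trig c3 s3).
Hypotheses (na : a != 0) (nb : b != 0) (nd : d != 0).

Let S := Smat (qstate c1 s1) (a *: qstate (- s1) c1)
              (qstate c2 s2) (b *: qstate (- s2) c2)
              (qstate c3 s3) (d *: qstate (- s3) c3).
Let B := prod_states (by_party (roleA c1 s1) (roleB c2 s2) (roleC c3 s3)).

Lemma std_orthonormal : adj B *m B = 1%:M.
Proof.
have := @prod_states_gram _ (by_party (roleA c1 s1) (roleB c2 s2) (roleC c3 s3))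
          (idop C).
rewrite -/B tens_idop mulmx1 => gram; apply/matrixP=> i j; rewrite gram.
by rewrite -(gram3_1 t1 t2 t3) [RHS]mxE.
Qed.

Lemma std_basis : orthonormal_basis_of S B.
Proof.
split; first exact: std_orthonormal.
apply: (@span_eq_monomial _ _ _ id (fun j => [:: 1; 1; d; a * b]`_j)) => //.
  by elim/ord4P; rewrite /= ?oner_eq0 ?mulf_neq0.
elim/ord4P; apply/colP=> i;
  by rewrite col_prod_states !mxE /= /la /ma /lb /mb /lc /mc /=; ring.
Qed.

(* An orthonormal product basis of the whole space that contains S_2, S_3 and S_4. *)
Definition sep_states (m : 'I_8) : (C * C) * (C * C) * (C * C) :=
  nth ((0, 0), (0, 0), (0, 0))
  [:: ((1, 0), (c2, s2), (c3, s3)); ((c1, s1), (1, 0), (- s3, c3));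
      ((- s1, c1), (- s2, c2), (1, 0)); ((- s1, c1), (c2, s2), (- s3, c3));
      ((c1, s1), (- s2, c2), (c3, s3)); ((0, 1), (c2, s2), (c3, s3));
      ((c1, s1), (0, 1), (- s3, c3)); ((- s1, c1), (- s2, c2), (0, 1))] m.

Definition sep_guess (m : 'I_8) : 'I_4 := nth i0 [:: i0; i0; i0; i0; i0; i1; i2; i3] m.

Lemma sep_states_unit m : [/\ unit_pair (sep_states m).1.1,
  unit_pair (sep_states m).1.2 & unit_pair (sep_states m).2].
Proof.
have ut c s : trig c s -> unit_pair (c, s) /\ unit_pair (- s, c).
  move=> tr; have [? ? _ _ ?] := tr; have [? ? _ _ ?] := trig_perp tr.
  by split; split.
have [u1 u1'] := ut _ _ t1; have [u2 u2'] := ut _ _ t2; have [u3 u3'] := ut _ _ t3.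
have u0 : unit_pair (1, 0).
  by split; rewrite /= ?conjC0 ?conjC1 // expr1n expr0n addr0.
have u0' : unit_pair (0, 1).
  by split; rewrite /= ?conjC0 ?conjC1 // expr1n expr0n add0r.
by case: m => [[|[|[|[|[|[|[|[|//]]]]]]]] lt_m].
Qed.

Lemma std_sep_distinguishable : sep_distinguishable B.
Proof.
pose M m := (proj (sep_states m).1.1, proj (sep_states m).1.2, proj (sep_states m).2).
exists 8, M, sep_guess => Mop.
have sum1 : \sum_m adj (Mop m) *m Mop m = 1%:M.
  have -> : \sum_m adj (Mop m) *m Mop m = \sum_m Mop m.
    apply: eq_bigr => m _; have [h1 h2 h3] := sep_states_unit m.
    by rewrite /Mop adj_kron3 kron3M !proj_sqr.
  have [c1R s1R _ _ cs1] := t1; have [c2R s2R _ _ cs2] := t2.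
  have [c3R s3R _ _ cs3] := t3.
  have e0 : proj (0, 1) = 1 - proj (1, 0).
    rewrite -(@proj_compl 1 0) ?conjC0 ?conjC1 // ?expr1n ?expr0n ?addr0 //.
    by rewrite oppr0 addrC addKr.
  have e1 : proj (- s1, c1) = 1 - proj (c1, s1)
    by rewrite -(proj_compl c1R s1R cs1) addrC addKr.
  have e2 : proj (- s2, c2) = 1 - proj (c2, s2)
    by rewrite -(proj_compl c2R s2R cs2) addrC addKr.
  have e3 : proj (- s3, c3) = 1 - proj (c3, s3)
    by rewrite -(proj_compl c3R s3R cs3) addrC addKr.
  (* Summing |0> with |1> where they pair up leaves the projectors 1BC, A1C^perp, A^perp B^perp 1,
     A^perp B C^perp and A B^perp C, which exhaust the eight products of A or A^perp, B or B^perp, C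
     or C^perp. *)
  rewrite !big_ord_recl big_ord0 /Mop /M /= e0 e1 e2 e3 -kron3_1.
  move: (proj (1, 0)) (proj (c1, s1)) (proj (c2, s2)) (proj (c3, s3)) => P0 P1 P2 P3.
  apply/matrixP=> i j; rewrite !mxE.
  move: ((bit1 i == bit1 j)%:R : C) ((bit2 i == bit2 j)%:R : C) ((bit3 i == bit3 j)%:R : C).
  by move=> x y z; ring.
split=> // j.
(* A vector announcing another index is orthogonal to S_j in at least one tensor factor. *)
have kill m : sep_guess m != j -> Mop m *m col j B = 0.
  have [h1 h2 h3] := sep_states_unit m.
  rewrite col_prod_states kron3_ket3 /by_party /= /roleA /roleB /roleC !proj_qstate //.
  move=> gj; rewrite ket3Z.
  suff -> : ((sep_states m).1.1.1 * la c1 s1 j + (sep_states m).1.1.2 * ma c1 s1 j) *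
    ((sep_states m).1.2.1 * lb c2 s2 j + (sep_states m).1.2.2 * mb c2 s2 j) *
    ((sep_states m).2.1 * lc c3 s3 j + (sep_states m).2.2 * mc c3 s3 j) = 0.
    by rewrite scale0r.
  move: gj {h1 h2 h3}; rewrite /sep_states /la /ma /lb /mb /lc /mc.
  by elim/ord4P: j; case: m => [[|[|[|[|[|[|[|[|//]]]]]]]] lt_m] //= _; ring.
have tot : \sum_m sqnorm (Mop m *m col j B) = 1.
  have -> : 1 = (adj (col j B) *m (1%:M *m col j B)) 0 0.
    rewrite mul1mx; have /matrixP/(_ j j) := std_orthonormal; rewrite !mxE eqxx mulr1n => <-.
    by apply: eq_bigr => l _; rewrite !mxE.
  rewrite -sum1 mulmx_suml mulmx_sumr summxE.
  by apply: eq_bigr => y _; rewrite sqnormE daggerM !mulmxA.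
rewrite -[RHS]tot [RHS](bigID (fun m => sep_guess m == j)) /=.
rewrite [X in _ + X]big1 ?addr0 //.
by move=> m /kill ->; rewrite /sqnorm big1 // => i _; rewrite mxE normr0 expr0n.
Qed.

End Separable.

(** * Orthogonal qubit vectors, and the theorem *)

Section Perp.
Variable C : numClosedFieldType.
Local Notation adj := (@adj C _ _).

Lemma trig_pos (c s : C) : 0 < c -> 0 < s -> c ^+ 2 + s ^+ 2 = 1 -> trig c s.
Proof.
by move=> c0 s0 cs; split; rewrite ?gt_eqF //; apply/CrealP/gtr0_real.
Qed.

(** The orthogonal complement of a qubit state is a line, so the given unit vector is [(- s, c)] up
    to a scalar, read off from the second coordinate. *)
Lemma perp_qstate (c s : C) (v : 'cV[C]_2) : trig c s -> sqnorm v = 1 ->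
  adj (qstate c s) *m v = 0 -> exists2 a, a != 0 & v = a *: qstate (- s) c.
Proof.
move=> [cR sR nc ns cs] nv /matrixP/(_ 0 0).
rewrite !mxE sum2 !daggerE !qstateE cR sR => dot0.
have ev : v = (v 1 0 / c) *: qstate (- s) c.
  apply/colP; elim/ord2P; rewrite mxE qstateE; last by rewrite mulfVK.
  apply: (mulfI nc); apply: (lin_comb dot0); by field.
exists (v 1 0 / c) => //; apply/eqP=> a0.
move: nv; rewrite ev a0 scale0r /sqnorm big1 => [/eqP|i _].
  by rewrite eq_sym oner_eq0.
by rewrite mxE normr0 expr0n.
Qed.

End Perp.

Theorem theorem5 (C : numClosedFieldType)
  (c1 s1 c2 s2 c3 s3 : C)
  (hc1 : 0 < c1) (hs1 : 0 < s1) (h1 : c1 ^+ 2 + s1 ^+ 2 = 1)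
  (hc2 : 0 < c2) (hs2 : 0 < s2) (h2 : c2 ^+ 2 + s2 ^+ 2 = 1)
  (hc3 : 0 < c3) (hs3 : 0 < s3) (h3 : c3 ^+ 2 + s3 ^+ 2 = 1)
  (Ap Bp Cp : 'cV[C]_2)
  (hAp : sqnorm Ap = 1) (hAo : adj (qstate c1 s1) *m Ap = 0)
  (hBp : sqnorm Bp = 1) (hBo : adj (qstate c2 s2) *m Bp = 0)
  (hCp : sqnorm Cp = 1) (hCo : adj (qstate c3 s3) *m Cp = 0) :
  let S := Smat (qstate c1 s1) Ap (qstate c2 s2) Bp (qstate c3 s3) Cp in
  (forall (k : nat) (B : 'M[C]_(8, k)),
     orthonormal_basis_of S B -> ~ locc_distinguishable B) /\
  (exists (k : nat) (B : 'M[C]_(8, k)),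
     orthonormal_basis_of S B /\ sep_distinguishable B).
Proof.
have t1 := trig_pos hc1 hs1 h1; have t2 := trig_pos hc2 hs2 h2.
have t3 := trig_pos hc3 hs3 h3.
have [a na ->] := perp_qstate t1 hAp hAo.
have [b nb ->] := perp_qstate t2 hBp hBo.
have [d nd ->] := perp_qstate t3 hCp hCo; move=> S; split.
  by move=> k B; apply: not_locc_distinguishable.
exists 4, (prod_states (by_party (roleA c1 s1) (roleB c2 s2) (roleC c3 s3))).
split; first exact: std_basis.
exact: std_sep_distinguishable.
Qed.
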